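(* Let $\mathcal{X}_\hbar(\mathbb{C}^2)$ be the $\hbar$-adic quantum plane, with basis $\{T^j_m\}$ and multiplication map $\mu_\hbar$, let $\mathcal{X}=\mathbb{C}[x_-,x_+]$ be its undeformed limit with basis $T'^j_m=\lim_{\hbar\to0}T^j_m$ and commutative multiplication $\mu=\lim_{\hbar\to0}\mu_\hbar$, and identify $\mathcal{X}_\hbar(\mathbb{C}^2)$ with $\mathcal{X}[[\hbar]]$ as $\mathbb{C}[[\hbar]]$-modules by $T^j_m\leftrightarrow T'^j_m$. Let $\mathcal{F}_{\mathrm{s}}$ be the standard twist from $\mathcal{U}(\mathrm{su}_2)$ to $\mathcal{U}_\hbar(\mathrm{su}_2)$. Then $\mu_\hbar$ is the deformation of $\mu$ by $\mathcal{F}_{\mathrm{s}}$: $$\mu_\hbar(x\otimes y)=\mu\big(\mathcal{F}_{\mathrm{s}}^{-1}\triangleright[x\otimes y]\big)\qquad\text{for all }x,y\in\mathcal{X}[[\hbar]].$$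
   Context: $\mathcal{U}(\mathrm{su}_2)$ is the complex enveloping algebra generated by $E,H,F$ with $[H,E]=2E$, $[H,F]=-2F$, $[E,F]=H$, canonical Hopf structure $\Delta(g)=g\otimes1+1\otimes g$, $\varepsilon(g)=0$, $S(g)=-g$ on generators, and $*$-structure $E^*=F$, $H^*=H$, $F^*=E$. $\mathcal{U}_\hbar(\mathrm{su}_2)$ is the complex $\hbar$-adic algebra generated by $E,H,F$ with $[H,E]=2E$, $[H,F]=-2F$, $[E,F]=\frac{e^{\hbar H}-e^{-\hbar H}}{e^\hbar-e^{-\hbar}}$, Hopf structure $\Delta'(E)=E\otimes e^{\hbar H}+1\otimes E$, $\Delta'(F)=F\otimes1+e^{-\hbar H}\otimes F$, $\Delta'(H)=H\otimes1+1\otimes H$, $S'(E)=-Ee^{-\hbar H}$, $S'(F)=-e^{\hbar H}F$, $S'(H)=-H$, $\varepsilon'(E)=\varepsilon'(F)=\varepsilon'(H)=0$, and involution $E^{*'}=Fe^{\hbar H}$, $F^{*'}=e^{-\hbar H}E$, $H^{*'}=H$. Put $q=e^\hbar$, $[n]=\frac{q^n-q^{-n}}{q-q^{-1}}$, $[n]!=[1]\cdots[n]$. For $j\in\frac12\mathbb{N}_0$, the spin-$j$ representation $\rho^j_\hbar$ of $\mathcal{U}_\hbar(\mathrm{su}_2)$ acts on the free $\mathbb{C}[[\hbar]]$-module $V^j[[\hbar]]$ with orthonormal basis $|j,m\rangle$, $m=-j,\dots,j$, by $E|j,m\rangle=q^{m+1}\sqrt{[j+m+1][j-m]}\,|j,m+1\rangle$,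 $F|j,m\rangle=q^{-m}\sqrt{[j+m][j-m+1]}\,|j,m-1\rangle$, $H|j,m\rangle=2m|j,m\rangle$. $\rho^j$ is the undeformed ($\hbar=0$) spin-$j$ representation of $\mathcal{U}(\mathrm{su}_2)$ in the same basis, extended $\hbar$-adically. $\alpha:\mathcal{U}_\hbar(\mathrm{su}_2)\to\mathcal{U}(\mathrm{su}_2)[[\hbar]]$ is the $*$-algebra isomorphism with $\alpha=\mathrm{id}+O(\hbar)$, $\alpha(H)=H$ and $\rho_\hbar^j=\rho^j\circ\alpha$ for all $j$; $\Delta_\hbar:=(\alpha\otimes\alpha)\circ\Delta'\circ\alpha^{-1}$. A Drinfeld twist from $\mathcal{U}(\mathrm{su}_2)$ to $\mathcal{U}_\hbar(\mathrm{su}_2)$ is an invertible $\mathcal{F}\in(\mathcal{U}(\mathrm{su}_2)\otimes\mathcal{U}(\mathrm{su}_2))[[\hbar]]$ with $\Delta_\hbar(g)=\mathcal{F}\Delta(g)\mathcal{F}^{-1}$ for all $g$, assumed counital: $(\varepsilon\otimes\mathrm{id})(\mathcal{F})=1=(\mathrm{id}\otimes\varepsilon)(\mathcal{F})$. The $q$-Clebsch-Gordan coefficients $C_q(j_1,m_1;j_2,m_2|j,m)\in\mathbb{R}[[\hbar]]$ are the coefficients, for $|j_1-j_2|\le j\le j_1+j_2$ in integer steps, of the embedding $|j,m\rangle\mapsto\sum_{m_1,m_2}C_q(j_1,m_1;j_2,m_2|j,m)\,|j_1,m_1\rangle\otimes|j_2,m_2\rangle$ which intertwines $\rho^j_\hbar$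 with $(\rho_\hbar^{j_1}\otimes\rho_\hbar^{j_2})\circ\Delta'$, normalized to form an orthogonal matrix (in the indices $(m_1,m_2)$ and $(j,m)$), with signs fixed so that for $\hbar\to0$ they become the ordinary (undeformed) Clebsch-Gordan coefficients $C(j_1,m_1;j_2,m_2|j,m)$ (in particular $C_q(j_1,j_1;j_2,j_2|j_1+j_2,j_1+j_2)=1$). The standard twist $\mathcal{F}_{\mathrm{s}}$ is the unique Drinfeld twist from $\mathcal{U}(\mathrm{su}_2)$ to $\mathcal{U}_\hbar(\mathrm{su}_2)$ with $\langle j_1,m_1;j_2,m_2|(\rho^{j_1}\otimes\rho^{j_2})(\mathcal{F}_{\mathrm{s}})|j_1,m_1';j_2,m_2'\rangle=\sum_{j,m}C_q(j_1,m_1;j_2,m_2|j,m)\,C(j_1,m_1';j_2,m_2'|j,m)$ for all $j_1,j_2$. The $\hbar$-adic quantum plane $\mathcal{X}_\hbar(\mathbb{C}^2)$ is the $\hbar$-adic algebra generated by $x_-$, $x_+$ (indices $\pm=\pm\frac12$) with the relation $x_-x_+=q\,x_+x_-$; it is a $\mathcal{U}_\hbar(\mathrm{su}_2)$-module algebra by $g\triangleright x_m=\sum_{m'}x_{m'}\,\rho_\hbar^{1/2}(g)^{m'}{}_m$. Its basis reducing it into irreducibles is $$T^j_m=\left(q^{-(j+m)(j-m)}\frac{[2j]!}{[j-m]!\,[j+m]!}\right)^{1/2}x_-^{j-m}x_+^{j+m},\qquad j\in\tfrac12\mathbb{N}_0,\ m=-j,\dots,j,$$ satisfying $g\triangleright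 T^j_m=\sum_{m'}T^j_{m'}\rho^j_\hbar(g)^{m'}{}_m$. In this basis its product is $\mu_\hbar(T^{j_1}_{m_1}\otimes T^{j_2}_{m_2})=C_q(j_1,m_1;j_2,m_2|j_1+j_2,m_1+m_2)\,T^{j_1+j_2}_{m_1+m_2}$. In the limit, $T'^j_m=\binom{2j}{j+m}^{1/2}x_-^{j-m}x_+^{j+m}$ and $\mu(T'^{j_1}_{m_1}\otimes T'^{j_2}_{m_2})=C(j_1,m_1;j_2,m_2|j_1+j_2,m_1+m_2)\,T'^{j_1+j_2}_{m_1+m_2}$. $\mathcal{U}(\mathrm{su}_2)[[\hbar]]$ acts on $\mathcal{X}[[\hbar]]$ by $g\triangleright T'^j_m=\sum_{m'}T'^j_{m'}\rho^j(g)^{m'}{}_m$ (i.e. by derivations, $x_\pm$ carrying the fundamental representation), and $(\mathcal{U}(\mathrm{su}_2)\otimes\mathcal{U}(\mathrm{su}_2))[[\hbar]]$ acts on $(\mathcal{X}\otimes\mathcal{X})[[\hbar]]$ factorwise. *)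

(* Defs.v *)
From HB Require Import structures.
From mathcomp Require Import all_boot all_order all_algebra.
From mathcomp Require Import boolp classical_sets reals complex mpoly.

Set Implicit Arguments.
Unset Strict Implicit.
Unset Printing Implicit Defensive.

Import Order.TTheory GRing.Theory Num.Theory.
Local Open Scope ring_scope.
Local Open Scope complex_scope.

Record fps (V : Type) := FPS { fps_coef : nat -> V }.

Notation "{ 'fps' V }" := (fps V) (at level 0, format "{ 'fps'  V }").
Notation "f `[ n ]" := (fps_coef f n)
  (at level 3, n at level 200, left associativity, format "f `[ n ]").

HB.instance Definition _ (V : Type) := gen_eqMixin {fps V}.
HB.instance Definition _ (V : Type) := gen_choiceMixin {fps V}.

Lemma fpsP (V : Type) (f g : {fps V}) :
  (forall n, f`[n] = g`[n]) -> f = g.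
Proof. by case: f g => [f] [g] /= /funext ->. Qed.

Definition fps_map (V W : Type) (u : V -> W) (f : {fps V}) : {fps W} :=
  FPS (fun n => u f`[n]).

Definition fps_const (V : nmodType) (v : V) : {fps V} :=
  FPS (fun n => if n is 0%N then v else 0).

(* the extension of a map [b] of two arguments to power series by the Cauchy
   product; products, actions and tensor products of series are instances *)
Definition fps_bilin (V W P : nmodType) (b : V -> W -> P)
    (f : {fps V}) (g : {fps W}) : {fps P} :=
  FPS (fun n => \sum_(i < n.+1) b f`[i] g`[(n - i)%N]).

Section FpsZmodule.
Variable V : zmodType.

Let add (f g : {fps V}) := FPS (fun n => f`[n] + g`[n]).
Let opp (f : {fps V}) := FPS (fun n => - f`[n]).

Fact fps_addA : associative add.
Proof. by move=> f g h; apply: fpsP => n /=; rewrite addrA. Qed.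
Fact fps_addC : commutative add.
Proof. by move=> f g; apply: fpsP => n /=; rewrite addrC. Qed.
Fact fps_add0 : left_id (fps_const 0) add.
Proof. by move=> f; apply: fpsP => -[|n] /=; rewrite add0r. Qed.
Fact fps_addN : left_inverse (fps_const 0) opp add.
Proof. by move=> f; apply: fpsP => -[|n] /=; rewrite addNr. Qed.

HB.instance Definition _ := GRing.isZmodule.Build {fps V}
  fps_addA fps_addC fps_add0 fps_addN.

Lemma fps_coefD (f g : {fps V}) n : (f + g)`[n] = f`[n] + g`[n].
Proof. by []. Qed.
Lemma fps_coef0 n : (0 : {fps V})`[n] = 0.
Proof. by case: n. Qed.

End FpsZmodule.

Definition biadditive (V W P : zmodType) (b : V -> W -> P) : Prop :=
  (forall v, {morph b v : x y / x + y}) /\ (forall w, {morph b^~ w : x y / x + y}).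

Section FpsBilin.
Variables (V W P : zmodType) (b : V -> W -> P).
Hypothesis hb : biadditive b.

Lemma biadd0r v : b v 0 = 0.
Proof. by apply: (addrI (b v 0)); rewrite -hb.1 !addr0. Qed.
Lemma biadd0l w : b 0 w = 0.
Proof. by apply: (addrI (b 0 w)); rewrite -(hb.2 w) !addr0. Qed.
Lemma biadd_sumr v I (r : seq I) (Q : pred I) (F : I -> W) :
  b v (\sum_(i <- r | Q i) F i) = \sum_(i <- r | Q i) b v (F i).
Proof. exact: (big_morph _ (hb.1 v) (biadd0r v)). Qed.
Lemma biadd_suml w I (r : seq I) (Q : pred I) (F : I -> V) :
  b (\sum_(i <- r | Q i) F i) w = \sum_(i <- r | Q i) b (F i) w.
Proof. exact: (big_morph (b^~ w) (hb.2 w) (biadd0l w)). Qed.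

Lemma fps_bilinDr f : {morph fps_bilin b f : x y / x + y}.
Proof.
move=> g h; apply: fpsP => n /=; rewrite -big_split; apply: eq_bigr => i _.
exact: hb.1.
Qed.
Lemma fps_bilinDl g : {morph fps_bilin b ^~ g : x y / x + y}.
Proof.
move=> f h; apply: fpsP => n /=; rewrite -big_split; apply: eq_bigr => i _.
exact: (hb.2 _).
Qed.
Lemma fps_bilin_constl v g : fps_bilin b (fps_const v) g = fps_map (b v) g.
Proof.
apply: fpsP => n /=; rewrite big_ord_recl /= subn0 big1 ?addr0 // => i _.
by rewrite biadd0l.
Qed.
Lemma fps_bilin_constr f w : fps_bilin b f (fps_const w) = fps_map (b^~ w) f.
Proof.
apply: fpsP => n /=; rewrite big_ord_recr /= subnn big1 ?add0r // => i _.
by rewrite -(subnSK (ltn_ord i)) /= biadd0r.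
Qed.
End FpsBilin.

Lemma fps_bilinA (V1 V2 V3 V12 V23 P : zmodType)
    (b12 : V1 -> V2 -> V12) (b23 : V2 -> V3 -> V23)
    (l : V12 -> V3 -> P) (r : V1 -> V23 -> P) :
  biadditive l -> biadditive r ->
  (forall x y z, r x (b23 y z) = l (b12 x y) z) ->
  forall f g h, fps_bilin r f (fps_bilin b23 g h)
              = fps_bilin l (fps_bilin b12 f g) h.
Proof.
move=> hl hr E f g h; apply: fpsP => n /=.
pose c3 j k := r f`[j] (b23 g`[(n - j - k)%N] h`[k]).
transitivity (\sum_(j < n.+1) \sum_(k < n.+1 | (k <= n - j)%N) c3 j k).
  apply: eq_bigr => j _; rewrite (biadd_sumr hr).
  rewrite (reindex_inj rev_ord_inj) /= (big_ord_narrow_leq (leq_subr _ _)).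
  apply: eq_bigr => k _; rewrite /c3 subSS subKn //.
  by rewrite -ltnS.
transitivity (\sum_(k < n.+1) \sum_(j < n.+1 | (j <= n - k)%N) c3 j k).
  rewrite (exchange_big_dep predT) //=; apply: eq_bigr => k _.
  apply: eq_bigl => j; have hj := ltn_ord j; have hk := ltn_ord k.
  by rewrite !ltnS in hj hk *; rewrite (leq_subRL _ hj) (leq_subRL _ hk) addnC.
rewrite (reindex_inj rev_ord_inj) /=; apply: eq_bigr => i _.
rewrite (biadd_suml hl) subSS.
have le_in : (i <= n)%N by rewrite -ltnS.
rewrite subKn // (big_ord_narrow_leq le_in).
apply: eq_bigr => j _; rewrite /c3 -E; congr (r _ (b23 _`[_] _)).
have le_ji : (j <= i)%N by rewrite -ltnS.
by rewrite subnAC subKn.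
Qed.

Lemma mul_biadditive (A : pzRingType) : biadditive (@GRing.mul A).
Proof. by split=> x y z; rewrite (mulrDr, mulrDl). Qed.
Lemma scale_biadditive (S : pzRingType) (V : lmodType S) :
  biadditive (@GRing.scale S V).
Proof. by split=> x y z; rewrite (scalerDr, scalerDl). Qed.

Section FpsRing.
Variable A : nzRingType.
Let one : {fps A} := fps_const 1.
Let mul := fps_bilin (@GRing.mul A).

Fact fps_mulA : associative mul.
Proof.
by apply: fps_bilinA (mul_biadditive A) (mul_biadditive A) _ => x y z; exact: mulrA.
Qed.
Fact fps_mul1 : left_id one mul.
Proof.
move=> f; rewrite /mul fps_bilin_constl; last exact: mul_biadditive.
by apply: fpsP => n /=; rewrite mul1r.
Qed.
Fact fps_1mul : right_id one mul.
Proof.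
move=> f; rewrite /mul fps_bilin_constr; last exact: mul_biadditive.
by apply: fpsP => n /=; rewrite mulr1.
Qed.
Fact fps_mulDl : left_distributive mul +%R.
Proof. by move=> f g h; apply: (fps_bilinDl (mul_biadditive A)). Qed.
Fact fps_mulDr : right_distributive mul +%R.
Proof. by move=> f g h; apply: (fps_bilinDr (mul_biadditive A)). Qed.
Fact fps_1neq0 : one != 0.
Proof. by apply/eqP => /(congr1 (fun f => f`[0])) /eqP; rewrite oner_eq0. Qed.

HB.instance Definition _ := GRing.Zmodule_isNzRing.Build {fps A}
  fps_mulA fps_mul1 fps_1mul fps_mulDl fps_mulDr fps_1neq0.
End FpsRing.

Fact fps_mulC (A : comNzRingType) : commutative (@GRing.mul {fps A}).
Proof.
move=> f g; apply: fpsP => n /=; rewrite (reindex_inj rev_ord_inj) /=.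
by apply: eq_bigr => i _; rewrite subSS (subKn (ltnSE (ltn_ord i))) mulrC.
Qed.
HB.instance Definition _ (A : comNzRingType) :=
  GRing.PzRing_hasCommutativeMul.Build {fps A} (@fps_mulC A).

Section FpsLmodule.
Variables (S : nzRingType) (V : lmodType S).
Let scale := fps_bilin (@GRing.scale S V).

Fact fps_scaleA (f g : {fps S}) h : scale f (scale g h) = scale (f * g) h.
Proof.
by apply: fps_bilinA (scale_biadditive V) (scale_biadditive V) _ f g h => x y z; exact: scalerA.
Qed.
Fact fps_scale1 : left_id 1 scale.
Proof.
move=> f; rewrite /scale fps_bilin_constl; last exact: scale_biadditive.
by apply: fpsP => n /=; rewrite scale1r.
Qed.
Fact fps_scaleDr : right_distributive scale +%R.
Proof. by move=> f g h; apply: (fps_bilinDr (scale_biadditive V)). Qed.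
Fact fps_scaleDl h : {morph scale^~ h : f g / f + g}.
Proof. by move=> f g; apply: (fps_bilinDl (scale_biadditive V)). Qed.

HB.instance Definition _ := GRing.Zmodule_isLmodule.Build {fps S} {fps V}
  fps_scaleA fps_scale1 fps_scaleDr fps_scaleDl.
End FpsLmodule.

Section FpsAlgebra.
Variables (S : comNzRingType) (A : algType S).

Fact fps_scaleAl (c : {fps S}) (f g : {fps A}) : c *: (f * g) = c *: f * g.
Proof.
apply: fps_bilinA => [||x y z]; [exact: mul_biadditive|exact: scale_biadditive|].
exact: scalerAl.
Qed.
HB.instance Definition _ := GRing.Lmodule_isLalgebra.Build {fps S} {fps A} fps_scaleAl.

Fact fps_scaleAr (c : {fps S}) (f g : {fps A}) : c *: (f * g) = f * (c *: g).
Proof.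
have scC (d : {fps S}) (h : {fps A}) :
    d *: h = fps_bilin (fun x s => s *: x) h d.
  apply: fpsP => n /=; rewrite (reindex_inj rev_ord_inj) /=.
  by apply: eq_bigr => i _; rewrite subSS (subKn (ltnSE (ltn_ord i))).
rewrite !scC; symmetry.
apply: fps_bilinA => [||x y z]; last by rewrite scalerAr.
  by split=> x y z; rewrite (scalerDr, scalerDl).
exact: mul_biadditive.
Qed.
HB.instance Definition _ := GRing.Lalgebra_isAlgebra.Build {fps S} {fps A} fps_scaleAr.
End FpsAlgebra.

Definition bilinear (S : comNzRingType) (V W P : lmodType S) (b : V -> W -> P) : Prop :=
  (forall v, linear (b v)) /\ (forall w, linear (b^~ w)).

(* [t] is universal among the bilinear maps into the modules of the class
   [test]: all modules for the algebraic tensor product, the h-adic modules for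
   the completed one *)
Definition tensor_for (S : comNzRingType) (test : lmodType S -> Prop)
    (V W T : lmodType S) (t : V -> W -> T) : Prop :=
  bilinear t /\
  forall P : lmodType S, test P -> forall b : V -> W -> P, bilinear b ->
    exists f : T -> P,
      [/\ linear f, (forall v w, f (t v w) = b v w)
        & forall f', linear f' -> (forall v w, f' (t v w) = b v w) -> f' =1 f].

Definition tensor_product (S : comNzRingType) (V W T : lmodType S) (t : V -> W -> T) :=
  tensor_for (fun=> True) t.

(* the linear map sending [t v w] to [b v w] *)
Definition tensor_lift (S : comNzRingType) (V W T P : lmodType S)
    (t : V -> W -> T) (b : V -> W -> P) : T -> P :=
  xget (fun=> 0) [set f : T -> P | linear f /\ forall v w, f (t v w) = b v w].

Definition tensor_mul (S : comNzRingType) (A AA : algType S) (t : A -> A -> AA) : Prop :=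
  t 1 1 = 1 /\ forall a b c d, t a b * t c d = t (a * c) (b * d).

(* entry ((i, k), (i', k')) of (rho (x) rho')(u), the functional a (x) b |->
   rho(a)_{i i'} rho'(b)_{k k'}; matrices act on columns of coordinates *)
Definition tensor_entry (S : comNzRingType) (A AA : algType S) (t : A -> A -> AA)
    (m n : nat) (rho : A -> 'M[S]_m) (rho' : A -> 'M[S]_n)
    (i : 'I_m) (k : 'I_n) (i' : 'I_m) (k' : 'I_n) : AA -> S :=
  tensor_lift t (fun a b => rho a i i' * rho' b k k' : S^o).

(* Half-integers are doubled: the spin j is encoded by n = 2j and the basis
   vector |j,m> by the index i = j + m of 'I_n.+1, so that j - m = n - i, and
   [c a b n i k l] is C(a/2, i - a/2; b/2, k - b/2 | n/2, l - n/2). *)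
Definition cg_coef (S : Type) :=
  forall a b n : nat, 'I_a.+1 -> 'I_b.+1 -> 'I_n.+1 -> S.

Definition cg_range (a b n : nat) : bool :=
  (maxn a b - minn a b <= n <= a + b)%N && ~~ odd (a + b + n).

Definition cg_orthogonal (S : pzRingType) (c : cg_coef S) : Prop :=
  (forall a b n n' (l : 'I_n.+1) (l' : 'I_n'.+1),
     cg_range a b n -> cg_range a b n' ->
     \sum_i \sum_k c a b n i k l * c a b n' i k l'
     = ((n == n') && (l == l' :> nat))%:R) /\
  (forall a b (i i' : 'I_a.+1) (k k' : 'I_b.+1),
     \sum_(n < (a + b).+1 | cg_range a b n) \sum_(l < n.+1)
       c a b n i k l * c a b n i' k' l
     = ((i == i') && (k == k'))%:R).

(* |n, l> |-> \sum_(i, k) c(i, k | n, l) |a, i> (x) |b, k> intertwines rho n with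
   (rho a (x) rho b) o Delta *)
Definition cg_intertwines (S : comNzRingType) (A AA : algType S) (t : A -> A -> AA)
    (Delta : A -> AA) (rho : forall n, A -> 'M[S]_n.+1) (c : cg_coef S) : Prop :=
  forall a b n, cg_range a b n ->
  forall (g : A) (i : 'I_a.+1) (k : 'I_b.+1) (l : 'I_n.+1),
    \sum_i' \sum_k' tensor_entry t (rho a) (rho b) i k i' k' (Delta g) * c a b n i' k' l
    = \sum_l' c a b n i k l' * rho n g l' l.

Section Deformation.
Variable R : realType.
Local Notation C := R[i].
Local Notation K := {fps C}.

Definition hbar : K := FPS (fun n => (n == 1)%N%:R).

(* q^c = exp (c h) *)
Definition qpow (c : C) : K := FPS (fun n => c ^+ n / n`!%:R).

(* Exact division and square root in the domain C[[h]]; the square root is the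
   one with a nonnegative real constant term, and is only used for series that
   vanish or have a positive constant term. *)
Definition fps_div (f g : K) : K := xget 0 [set h | h * g = f].
Definition fps_sqrt (f : K) : K := xget 0 [set s | s * s = f /\ 0 <= s`[0]].

Definition qnum (n : nat) : K :=
  fps_div (qpow n%:R - qpow (- n%:R)) (qpow 1 - qpow (- 1)).
Definition qfact (n : nat) : K := \prod_(1 <= k < n.+1) qnum k.

Section Hadic.
Variable M : lmodType K.

Definition hdvd (N : nat) (x : M) : Prop := exists y, x = hbar ^+ N *: y.

Definition hlim (u : nat -> M) (x : M) : Prop :=
  forall N, exists n0, forall n, (n0 <= n)%N -> hdvd N (u n - x).

Definition hcauchy (u : nat -> M) : Prop :=
  forall N, exists n0, forall m n, (n0 <= m)%N -> (n0 <= n)%N -> hdvd N (u m - u n).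

(* torsion-free, separated and complete, i.e. topologically free *)
Definition hadic : Prop :=
  [/\ forall x : M, hbar *: x = 0 -> x = 0,
      forall x : M, (forall N, hdvd N x) -> x = 0
    & forall u : nat -> M, hcauchy u -> exists x, hlim u x].
End Hadic.

(* e^{c h x} in an h-adic algebra *)
Definition hexp (A : algType K) (c : C) (x : A) : A :=
  xget 0 [set s | hlim (fun n =>
    \sum_(k < n) (fps_const (c ^+ k / k`!%:R) * hbar ^+ k) *: x ^+ k) s].

Definition completed_tensor_product (V W T : lmodType K) (t : V -> W -> T) : Prop :=
  hadic T /\ tensor_for hadic t.

Definition su2_rel (A : algType C) (E H F : A) : Prop :=
  [/\ H * E - E * H = E *+ 2, H * F - F * H = - (F *+ 2) & E * F - F * E = H].

Definition is_Usu2 (U : algType C) (E H F : U) : Prop :=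
  su2_rel E H F /\
  forall (A : algType C) (E' H' F' : A), su2_rel E' H' F' ->
    exists f : {lrmorphism U -> A},
      [/\ f E = E', f H = H' & f F = F'] /\
      forall f' : {lrmorphism U -> A},
        [/\ f' E = E', f' H = H' & f' F = F'] -> f' =1 f.

(* the denominator q - q^-1 is cleared: h-adic algebras are torsion-free *)
Definition Uhsu2_rel (A : algType K) (E H F : A) : Prop :=
  [/\ H * E - E * H = E *+ 2, H * F - F * H = - (F *+ 2)
    & (qpow 1 - qpow (- 1)) *: (E * F - F * E) = hexp 1 H - hexp (- 1) H].

Definition is_Uhsu2 (U : algType K) (E H F : U) : Prop :=
  [/\ hadic U, Uhsu2_rel E H F &
  forall (A : algType K) (E' H' F' : A), hadic A -> Uhsu2_rel E' H' F' ->
    exists f : {lrmorphism U -> A},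
      [/\ f E = E', f H = H' & f F = F'] /\
      forall f' : {lrmorphism U -> A},
        [/\ f' E = E', f' H = H' & f' F = F'] -> f' =1 f].

(* antilinear with respect to the conjugation [cj] of the scalars *)
Definition involution (S : comNzRingType) (cj : S -> S) (A : algType S) (st : A -> A) : Prop :=
  [/\ {morph st : x y / x + y}, forall c x, st (c *: x) = cj c *: st x,
      forall x y, st (x * y) = st y * st x & involutive st].

Definition is_star (U : algType C) (E H F : U) (st : U -> U) : Prop :=
  involution Num.conj st /\ [/\ st E = F, st H = H & st F = E].

(* the scalar h is real: series are conjugated coefficientwise *)
Definition is_star_h (U : algType K) (E H F : U) (st : U -> U) : Prop :=
  involution (fps_map Num.conj) st /\
  [/\ st E = F * hexp 1 H, st H = H & st F = hexp (- 1) H * E].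

Definition is_coproduct (U UU : algType C) (t : U -> U -> UU) (E H F : U)
    (D : U -> UU) : Prop :=
  [/\ D E = t E 1 + t 1 E, D H = t H 1 + t 1 H & D F = t F 1 + t 1 F].

Definition is_coproduct_h (U UU : algType K) (t : U -> U -> UU) (E H F : U)
    (D : U -> UU) : Prop :=
  [/\ D E = t E (hexp 1 H) + t 1 E, D H = t H 1 + t 1 H
    & D F = t F 1 + t (hexp (- 1) H) F].

(* the magnetic number m = i - j *)
Definition mag (n : nat) (i : 'I_n.+1) : C := i%:R - n%:R / 2.

Definition is_spin_rep (U : algType C) (E H F : U) (rho : forall n, U -> 'M[C]_n.+1) : Prop :=
  forall n (i' i : 'I_n.+1),
  [/\ rho n E i' i = if i' == i.+1 :> nat then sqrtC (i.+1 * (n - i))%N%:R else 0,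
      rho n F i' i = if i'.+1 == i :> nat then sqrtC (i * (n - i).+1)%N%:R else 0
    & rho n H i' i = if i' == i then 2 * mag i else 0].

Definition is_spin_rep_h (U : algType K) (E H F : U) (rho : forall n, U -> 'M[K]_n.+1) : Prop :=
  forall n (i' i : 'I_n.+1),
  [/\ rho n E i' i = if i' == i.+1 :> nat
        then qpow (mag i + 1) * fps_sqrt (qnum i.+1 * qnum (n - i)) else 0,
      rho n F i' i = if i'.+1 == i :> nat
        then qpow (- mag i) * fps_sqrt (qnum i * qnum (n - i).+1) else 0
    & rho n H i' i = if i' == i then fps_const (2 * mag i) else 0].

(* the Condon-Shortley convention C(j1,j1;j2,j-j1|j,j) > 0 fixes the signs *)
Definition is_CG (U UU : algType C) (t : U -> U -> UU) (Delta : U -> UU)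
    (rho : forall n, U -> 'M[C]_n.+1) (c : cg_coef C) : Prop :=
  [/\ cg_intertwines t Delta rho c, cg_orthogonal c,
      forall a b n i k l, cg_range a b n -> c a b n i k l \is Num.real
    & forall a b n (k : 'I_b.+1), cg_range a b n -> k.*2 = (b + n - a)%N ->
        0 < c a b n ord_max k ord_max].

Definition is_qCG (U UU : algType K) (t : U -> U -> UU) (Delta : U -> UU)
    (rho : forall n, U -> 'M[K]_n.+1) (c0 : cg_coef C) (c : cg_coef K) : Prop :=
  [/\ cg_intertwines t Delta rho c, cg_orthogonal c,
      forall a b n i k l s, cg_range a b n -> (c a b n i k l)`[s] \is Num.real
    & forall a b n i k l, cg_range a b n -> (c a b n i k l)`[0] = c0 a b n i k l].

(* alpha = id + O(h) is expressed on the generators *)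
Definition is_alpha (U : algType C) (E H F : U) (star : U -> U) (rho : forall n, U -> 'M[C]_n.+1)
    (Uh : algType K) (Eh Hh Fh : Uh) (starh : Uh -> Uh) (rhoh : forall n, Uh -> 'M[K]_n.+1)
    (alpha : Uh -> {fps U}) : Prop :=
  [/\ (alpha Eh)`[0] = E /\ (alpha Fh)`[0] = F,
      alpha Hh = fps_const H,
      forall g, alpha (starh g) = fps_map star (alpha g)
    & forall n g i k, rhoh n g i k = fps_map (fun u => rho n u i k) (alpha g)].

(* Delta_h = (alpha (x) alpha) o Delta' o alpha^-1 *)
Definition Delta_hbar (U UU : algType C) (t : U -> U -> UU) (Uh UUh : algType K)
    (th : Uh -> Uh -> UUh) (Deltah : Uh -> UUh) (alpha : Uh -> {fps U})
    (alphaV : {fps U} -> Uh) (g : {fps U}) : {fps UU} :=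
  tensor_lift th (fun a b => fps_bilin t (alpha a) (alpha b)) (Deltah (alphaV g)).

Definition is_Drinfeld_twist (U UU : algType C) (t : U -> U -> UU) (Delta : U -> UU)
    (eps : U -> C) (Dh : {fps U} -> {fps UU}) (F Finv : {fps UU}) : Prop :=
  [/\ F * Finv = 1, Finv * F = 1,
      forall g, Dh g = F * fps_map Delta g * Finv,
      fps_map (tensor_lift t (fun a b => eps a *: b)) F = 1
    & fps_map (tensor_lift t (fun a b => eps b *: a)) F = 1].

Definition standard_matrix (U UU : algType C) (t : U -> U -> UU)
    (rho : forall n, U -> 'M[C]_n.+1) (c0 : cg_coef C) (c : cg_coef K) (F : {fps UU}) : Prop :=
  forall a b (i i' : 'I_a.+1) (k k' : 'I_b.+1),
    fps_map (tensor_entry t (rho a) (rho b) i k i' k') F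
    = \sum_(n < (a + b).+1 | cg_range a b n) \sum_(l < n.+1)
        c a b n i k l * fps_const (c0 a b n i' k' l).

Definition is_quantum_plane (X : algType K) (xm xp : X) : Prop :=
  [/\ hadic X, xm * xp = qpow 1 *: (xp * xm) &
  forall (A : algType K) (ym yp : A), hadic A -> ym * yp = qpow 1 *: (yp * ym) ->
    exists f : {lrmorphism X -> A}, [/\ f xm = ym, f xp = yp &
      forall f' : {lrmorphism X -> A}, f' xm = ym -> f' xp = yp -> f' =1 f]].

Definition Tbasis_h (X : algType K) (xm xp : X) (n : nat) (i : 'I_n.+1) : X :=
  fps_sqrt (fps_div (qpow (- (i * (n - i))%N%:R) * qfact n) (qfact (n - i) * qfact i))
  *: (xm ^+ (n - i) * xp ^+ i).

Local Notation X := {mpoly C[2]}.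

(* x_- and x_+ are the variables of index 0 and 1 *)
Definition Tbasis (n : nat) (i : 'I_n.+1) : X :=
  sqrtC 'C(n, i)%:R *: ('X_ord0 ^+ (n - i) * 'X_ord_max ^+ i).

Definition is_plane_action (U : algType C) (rho : forall n, U -> 'M[C]_n.+1)
    (act : U -> X -> X) : Prop :=
  bilinear act /\
  forall g n (i : 'I_n.+1), act g (Tbasis i) = \sum_i' rho n g i' i *: Tbasis i'.

(* (a (x) b) . (x (x) y) = (a . x) (x) (b . y) *)
Definition tensor_action (U UU : algType C) (t : U -> U -> UU) (act : U -> X -> X)
    (XX : lmodType C) (tX : X -> X -> XX) (u : UU) (w : XX) : XX :=
  tensor_lift t (fun a b => tensor_lift tX (fun x y => tX (act a x) (act b y)) w) u.

(* the product of [X] as a linear map on the tensor square *)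
Definition plane_mul (XX : lmodType C) (tX : X -> X -> XX) : XX -> X :=
  tensor_lift tX (fun x y => x * y).

End Deformation.

(* Main.v *)
(* Both sides are C[[h]]-bilinear, and a C[[h]]-linear map on X[[h]] is determined
   by its values on the constants T'^j_m, so only products of basis vectors have
   to be compared. The H-component of the intertwining relation and orthogonality
   give C_q = 1 at the highest weight; the F-component then determines the
   coefficients of the component j = j1 + j2 by descending induction, and their
   closed form is the structure constant of the quantum plane in the basis T^j_m.
   The constant terms in h give the undeformed product. Finally, with Q and C the
   matrices of the q-deformed and ordinary coefficients, the twist acts by Q C^T;
   its inverse V satisfies C^T V = Q^T, so that the undeformed product applied
   after V yields the j1 + j2 component of Q^T, the deformed structure constant. *)
From mathcomp Require Import all_boot all_order all_algebra.
From mathcomp Require Import boolp classical_sets reals complex mpoly.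
From mathcomp Require Import ring zify.
Require Import Defs.

Set Implicit Arguments.
Unset Strict Implicit.
Unset Printing Implicit Defensive.

Import Order.TTheory GRing.Theory Num.Theory.
Local Open Scope ring_scope.
Local Open Scope complex_scope.

(** * Power series over C and quantum integers *)

(** The coefficients of quotients and square roots are solved for one at a time, each from all
    earlier ones; the hypothesis says that [G n] looks at nothing else. *)
Lemma course_of_values_rec (T : Type) (x0 : T) (G : nat -> (nat -> T) -> T) :
  (forall n s s', (forall i, (i < n)%N -> s i = s' i) -> G n s = G n s') ->
  exists s : nat -> T, forall n, s n = G n s.
Proof.
move=> extG.
(* [L n] lists the first [n] values; beyond them [nth] yields the default [x0], which [G n] does not
   see. *)
pose fix L n := if n is m.+1 then rcons (L m) (G m (nth x0 (L m))) else [::].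
have szL n : size (L n) = n by elim: n => //= n IHn; rewrite size_rcons IHn.
have nthL n i : (i < n)%N -> nth x0 (L n) i = nth x0 (L i.+1) i.
  elim: n => // n IHn; rewrite ltnS leq_eqVlt => /predU1P[-> //|lt_in].
  by rewrite {1}/L -/L nth_rcons szL lt_in IHn.
exists (fun n => nth x0 (L n.+1) n) => n.
rewrite /L -/L nth_rcons szL ltnn eqxx; apply: extG => i /nthL.
by rewrite /L -/L.
Qed.

Section FpsCoef.

Lemma fps_coefN (V : zmodType) (f : {fps V}) n : (- f)`[n] = - f`[n].
Proof. by []. Qed.

Lemma fps_coefB (V : zmodType) (f g : {fps V}) n : (f - g)`[n] = f`[n] - g`[n].
Proof. by []. Qed.

Lemma fps_coef_sum (V : zmodType) I (r : seq I) (P : pred I) (f : I -> {fps V}) n :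
  (\sum_(i <- r | P i) f i)`[n] = \sum_(i <- r | P i) (f i)`[n].
Proof. exact: (big_morph (fun f : {fps V} => f`[n]) (fun f g => fps_coefD f g n) (fps_coef0 _ n)). Qed.

Lemma fps_coefM (A : nzRingType) (f g : {fps A}) n :
  (f * g)`[n] = \sum_(i < n.+1) f`[i] * g`[(n - i)%N].
Proof. by []. Qed.

Lemma fps_coefM0 (A : nzRingType) (f g : {fps A}) : (f * g)`[0] = f`[0] * g`[0].
Proof. by rewrite fps_coefM big_ord1. Qed.

Lemma fps_coef1 (A : nzRingType) n : (1 : {fps A})`[n] = (n == 0)%N%:R.
Proof. by case: n. Qed.

Variables (S : nzRingType) (V : lmodType S).

Lemma fps_const_scale (s : S) (f : {fps V}) n : (fps_const s *: f)`[n] = s *: f`[n].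
Proof.
transitivity ((fps_bilin *:%R (fps_const s) f)`[n]) => //.
by rewrite fps_bilin_constl //; apply: scale_biadditive.
Qed.

Lemma fps_scale_const (f : {fps S}) (v : V) n : (f *: fps_const v)`[n] = f`[n] *: v.
Proof.
transitivity ((fps_bilin *:%R f (fps_const v))`[n]) => //.
by rewrite fps_bilin_constr //; apply: scale_biadditive.
Qed.

Lemma fps_constD (v w : V) : fps_const (v + w) = fps_const v + fps_const w.
Proof. by apply: fpsP => -[|n] //=; rewrite addr0. Qed.

Lemma fps_constZ (s : S) (v : V) : fps_const (s *: v) = fps_const s *: fps_const v.
Proof. by apply: fpsP => -[|n]; rewrite fps_const_scale //= scaler0. Qed.

Lemma fps_coef_constM (s : S) (f : {fps S}) n : (fps_const s * f)`[n] = s * f`[n].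
Proof.
transitivity ((fps_bilin *%R (fps_const s) f)`[n]) => //.
by rewrite (fps_bilin_constl (mul_biadditive S)).
Qed.

Lemma fps_coef_Mconst (s : S) (f : {fps S}) n : (f * fps_const s)`[n] = f`[n] * s.
Proof.
transitivity ((fps_bilin *%R f (fps_const s))`[n]) => //.
by rewrite (fps_bilin_constr (mul_biadditive S)).
Qed.

End FpsCoef.

(** Once the lower coefficients of [g] vanish, coefficient [n] of the product is just [f][0] *
    g[[n]]. *)
Lemma fps_lreg (S : idomainType) (f g : {fps S}) : f`[0] != 0 -> f * g = 0 -> g = 0.
Proof.
move=> f0 fg0; apply: fpsP => n; rewrite fps_coef0.
elim/ltn_ind: n => n IHn; have := congr1 (fun u => u`[n]) fg0.
rewrite fps_coefM fps_coef0 big_ord_recl /= subn0 big1 ?addr0 => [/eqP|i _].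
  by rewrite mulf_eq0 (negPf f0) => /eqP.
by rewrite IHn ?mulr0 //; have := ltn_ord i; rewrite /bump leq0n; lia.
Qed.

Lemma fps_mulfI (S : idomainType) (f : {fps S}) :
  f`[0] != 0 -> injective ( *%R f).
Proof.
move=> f0 g h /eqP; rewrite -subr_eq0 -mulrBr => /eqP/(fps_lreg f0)/eqP.
by rewrite subr_eq0 => /eqP.
Qed.

Lemma fps_div_exists (S : fieldType) (f g : {fps S}) :
  g`[0] != 0 -> exists h, h * g = f.
Proof.
move=> g0.
pose G n (s : nat -> S) := (f`[n] - \sum_(i < n) s i * g`[(n - i)%N]) / g`[0].
have [|s Es] := @course_of_values_rec _ 0 G.
  move=> n s s' Ess'; congr ((_ - _) / _).
  by apply: eq_bigr => i _; rewrite Ess'.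
exists (FPS s); apply: fpsP => n; rewrite fps_coefM big_ord_recr /= subnn.
by rewrite Es mulfVK // addrC subrK.
Qed.

Section Real.
Variable R : realType.
Local Notation C := R[i].
Local Notation K := {fps C}.

Lemma fps_divK (f g : K) : g`[0] != 0 -> fps_div f g * g = f.
Proof. by move=> /(fps_div_exists f) hE; have := xgetPex 0 hE. Qed.

(** In coefficient n + 1 of s * s the two outer terms contribute 2 r s_(n+1) and all others involve
    s_1, ..., s_n only, so the equation can be solved for s_(n+1). *)
Lemma fps_sqrt_exists (f : K) : 0 < f`[0] -> exists s : K, s * s = f /\ 0 <= s`[0].
Proof.
move=> f0; pose r := sqrtC f`[0].
have r0 : r != 0 by rewrite sqrtC_eq0 gt_eqF.
pose G n (s : nat -> C) := if n is m.+1 then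
  (f`[n] - \sum_(i < m) s i.+1 * s (m - i)%N) / (r *+ 2) else r.
have [|s Es] := @course_of_values_rec _ 0 G.
  case=> // n s s' Ess' /=; congr ((_ - _) / _).
  by apply: eq_bigr => i _; rewrite !Ess' //; have := ltn_ord i; lia.
exists (FPS s); split; last by rewrite /= Es /= sqrtC_ge0 ltW.
apply: fpsP => -[|n]; first by rewrite fps_coefM0 /= Es /= -expr2 sqrtCK.
rewrite fps_coefM big_ord_recl big_ord_recr /= subnn subn0 (Es 0%N) /=.
have -> : \sum_(i < n) s (bump 0 i) * s (n.+1 - bump 0 i)%N
   = \sum_(i < n) s i.+1 * s (n - i)%N by [].
rewrite (Es n.+1) /=; set X := \sum_(i < n) _; field.
by [].
Qed.

Lemma fps_sqrtK (f : K) : 0 < f`[0] -> fps_sqrt f * fps_sqrt f = f.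
Proof. by move=> /fps_sqrt_exists hE; have [] := xgetPex 0 hE. Qed.

Lemma fps_sqrt_gt0 (f : K) : 0 < f`[0] -> 0 < (fps_sqrt f)`[0].
Proof.
move=> f0; have [E s0] := xgetPex 0 (fps_sqrt_exists f0).
rewrite lt_neqAle s0 andbT; apply: contraTneq f0 => /esym s00.
by rewrite -E fps_coefM0 [X in X * _]s00 mul0r ltxx.
Qed.

(** Here (f + g)(f - g) = 0, and f + g is cancellable by its positive constant term. Identities
    between square roots are thus checked on squares. *)
Lemma fps_sqr_inj (f g : K) : 0 < f`[0] -> 0 < g`[0] -> f * f = g * g -> f = g.
Proof.
move=> f0 g0 Efg; apply/eqP; rewrite -subr_eq0; apply/eqP.
have fg0 : (f + g)`[0] != 0 by rewrite gt_eqF // addr_gt0.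
by apply: (fps_lreg fg0); rewrite mulrBr !mulrDl Efg (mulrC g f); ring.
Qed.

Lemma qpow0 : qpow (0 : C) = 1.
Proof.
by apply: fpsP => -[|n]; rewrite fps_coef1 /= ?fact0 ?divr1 // exprS mul0r mul0r.
Qed.

Lemma qpow_coef0 (c : C) : (qpow c)`[0] = 1.
Proof. by rewrite /= divr1. Qed.

Lemma qpowD (c d : C) : qpow (c + d) = qpow c * qpow d.
Proof.
apply: fpsP => n; rewrite fps_coefM /= addrC exprDn mulr_suml; apply: eq_bigr => i _.
have le_in : (i <= n)%N by rewrite -ltnS.
rewrite -(bin_fact le_in) !natrM -mulr_natr.
have nz k : (k`!%:R : C) != 0 by rewrite pnatr_eq0 -lt0n fact_gt0.
have nzb : ('C(n, i)%:R : C) != 0 by rewrite pnatr_eq0 -lt0n bin_gt0.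
by field; rewrite !nz nzb.
Qed.

Lemma coef_hbarM (f : K) n : (hbar R * f)`[n] = if n is m.+1 then f`[m] else 0.
Proof.
rewrite fps_coefM; case: n => [|n]; first by rewrite big_ord1 /= mul0r.
rewrite !big_ord_recl /= mul0r add0r mul1r subSS subn0 big1 ?addr0 // => i _.
by rewrite mul0r.
Qed.

Lemma coef_hbarZ (V : lmodType C) (f : {fps V}) n :
  (hbar R *: f)`[n] = if n is m.+1 then f`[m] else 0.
Proof.
rewrite /GRing.scale /=; case: n => [|n]; first by rewrite big_ord1 /= scale0r.
rewrite !big_ord_recl /= scale0r add0r scale1r subSS subn0 big1 ?addr0 // => i _.
by rewrite scale0r.
Qed.

Lemma coef_hbarXM (f : K) N n :
  (hbar R ^+ N * f)`[n] = if (n < N)%N then 0 else f`[(n - N)%N].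
Proof.
elim: N n => [|N IHN] n; first by rewrite expr0 mul1r subn0.
by rewrite exprS -mulrA coef_hbarM; case: n => // n; rewrite IHN subSS.
Qed.

Local Notation qdelta := (qpow (1 : C) - qpow (- 1)).

(** The series q - q^-1 is not a unit, but it is [hbar] times a series with constant term 2. *)
Lemma qdelta_lreg (f : K) : qdelta * f = 0 -> f = 0.
Proof.
pose u : K := FPS (fun n => qdelta`[n.+1]).
have -> : qdelta = hbar R * u.
  by apply: fpsP => -[|n]; rewrite coef_hbarM // fps_coefB !qpow_coef0 subrr.
rewrite -mulrA => hu; apply: (@fps_lreg _ u).
  rewrite /= !expr1 divr1 divr1 opprK -mulr2n pnatr_eq0 //.
apply: fpsP => n; have := congr1 (fun f => f`[n.+1]) hu.
by rewrite coef_hbarM !fps_coef0.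
Qed.

Lemma qdelta_mulI (f g : K) : qdelta * f = qdelta * g -> f = g.
Proof.
move=> /eqP; rewrite -subr_eq0 -mulrBr => /eqP/qdelta_lreg/eqP.
by rewrite subr_eq0 => /eqP.
Qed.

(** Since q - q^-1 has no constant term, exactness of the division is proved by building the
    quotient from [n+1] = q [n] + q^-n. *)
Lemma qnumE n : qdelta * qnum R n = qpow n%:R - qpow (- n%:R).
Proof.
have : exists h, h * qdelta = qpow n%:R - qpow (- n%:R).
  elim: n => [|n [h Eh]]; first by exists 0; rewrite mul0r oppr0 subrr.
  exists (qpow 1 * h + qpow (- n%:R)).
  rewrite mulrDl -mulrA Eh !mulrBr -!qpowD -natr1.
  rewrite (addrC 1 n%:R) (addrC 1) (opprD n%:R); ring.
by move=> hE; rewrite mulrC; have := xgetPex 0 hE.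
Qed.

Lemma qnum0 : qnum R 0 = 0.
Proof. by apply: qdelta_mulI; rewrite qnumE oppr0 subrr mulr0. Qed.

Lemma qnum1 : qnum R 1 = 1.
Proof. by apply: qdelta_mulI; rewrite qnumE mulr1. Qed.

Lemma qnumD m n :
  qnum R (m + n) = qnum R m * qpow (- n%:R) + qnum R n * qpow m%:R.
Proof.
apply: qdelta_mulI; rewrite mulrDr !mulrA !qnumE !mulrBl -!qpowD natrD.
by rewrite -(opprD m%:R) (addrC n%:R) (addrC (- n%:R)); ring.
Qed.

Lemma qnum_coef0 n : (qnum R n)`[0] = n%:R.
Proof.
elim: n => [|n IHn]; first by rewrite qnum0.
rewrite -addn1 qnumD fps_coefD !fps_coefM0 IHn qnum1 !qpow_coef0.
by rewrite natrD !mulr1.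
Qed.

Lemma qfactS n : qfact R n.+1 = qfact R n * qnum R n.+1.
Proof. by rewrite /qfact big_nat_recr. Qed.

Lemma qfact_coef0 n : (qfact R n)`[0] = n`!%:R.
Proof.
elim: n => [|n IHn]; first by rewrite /qfact big_nil.
by rewrite qfactS fps_coefM0 IHn qnum_coef0 factS mulnC natrM.
Qed.

Lemma qfact_neq0 n : (qfact R n)`[0] != 0.
Proof. by rewrite qfact_coef0 pnatr_eq0 -lt0n fact_gt0. Qed.

End Real.

(** * Tensor products and h-adic limits *)

Section TensorProduct.
Variables (S : comNzRingType) (test : lmodType S -> Prop).
Variables (V W T : lmodType S) (t : V -> W -> T).
Hypothesis ht : tensor_for test t.

Lemma tensor_liftP (P : lmodType S) (b : V -> W -> P) : test P -> bilinear b ->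
  linear (tensor_lift t b) /\ forall v w, tensor_lift t b (t v w) = b v w.
Proof.
move=> tP bb; have [f [lf Ef _]] := ht.2 P tP b bb.
have fE : exists f : T -> P, linear f /\ forall v w, f (t v w) = b v w by exists f.
exact: (xgetPex (fun=> 0) fE).
Qed.

(** Both maps factor the same bilinear map, so they coincide with its universal factorization. *)
Lemma tensor_ext (P : lmodType S) (f g : T -> P) : test P -> linear f -> linear g ->
  (forall v w, f (t v w) = g (t v w)) -> f =1 g.
Proof.
move=> tP lf lg Efg.
have bb : bilinear (fun v w => g (t v w)).
  split=> [v c x y|w c x y]; rewrite ?(ht.1.1 v) ?(ht.1.2 w) lg //.
have [h [_ _ hu]] := ht.2 P tP _ bb.
by move=> x; rewrite (hu f) // (hu g).
Qed.

End TensorProduct.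

Lemma linear_fun0 (S : nzRingType) (V W : lmodType S) (f : V -> W) : linear f -> f 0 = 0.
Proof. by move=> lf; have := lf (-1) 0 0; rewrite scaler0 addr0 scaleN1r addNr. Qed.

Lemma linear_funZ (S : nzRingType) (V W : lmodType S) (f : V -> W) : linear f ->
  forall a x, f (a *: x) = a *: f x.
Proof. by move=> lf a x; have := lf a x 0; rewrite (linear_fun0 lf) !addr0. Qed.

Lemma linear_funD (S : nzRingType) (V W : lmodType S) (f : V -> W) : linear f ->
  forall x y, f (x + y) = f x + f y.
Proof. by move=> lf x y; have := lf 1 x y; rewrite !scale1r. Qed.

Lemma linear_fun_sum (S : nzRingType) (V W : lmodType S) (f : V -> W) : linear f ->
  forall I (r : seq I) (P : pred I) (F : I -> V),
  f (\sum_(i <- r | P i) F i) = \sum_(i <- r | P i) f (F i).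
Proof. by move=> lf I r P F; exact: (big_morph f (linear_funD lf) (linear_fun0 lf)). Qed.

Section TensorEntry.
Variables (S : comNzRingType) (test : lmodType S -> Prop).
Variables (A AA : algType S) (t : A -> A -> AA).
Hypotheses (ht : tensor_for test t) (testS : test S^o).
Variables (m n : nat) (rho : {lrmorphism A -> 'M[S]_m.+1}).
Variable rho' : {lrmorphism A -> 'M[S]_n.+1}.

Lemma tensor_entryP i k i' k' :
  linear (tensor_entry t rho rho' i k i' k' : AA -> S^o) /\
  forall a b, tensor_entry t rho rho' i k i' k' (t a b) = rho a i i' * rho' b k k'.
Proof.
apply: (tensor_liftP ht) => //; split=> [x|y] c v w.
  by rewrite linearP !mxE mulrDr mulrCA.
by rewrite linearP !mxE mulrDl -mulrA.
Qed.

(** Both sides are linear in [u] and in [v], so two uses of [tensor_ext] reduce the claim to pure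
    tensors, where it is the product of two matrix products. *)
Lemma tensor_entryM (htM : tensor_mul t) i k i' k' (u v : AA) :
  tensor_entry t rho rho' i k i' k' (u * v)
  = \sum_i1 \sum_k1 tensor_entry t rho rho' i k i1 k1 u
                    * tensor_entry t rho rho' i1 k1 i' k' v.
Proof.
have lE i1 k1 i2 k2 := (tensor_entryP i1 k1 i2 k2).1.
have eE i1 k1 i2 k2 := (tensor_entryP i1 k1 i2 k2).2.
move: v.
apply: (tensor_ext (P := S^o) ht testS) => [x y z|x y z|a b].
- by rewrite mulrDr -scalerAr lE.
- rewrite scaler_sumr -big_split; apply: eq_bigr => i1 _.
  rewrite scaler_sumr -big_split; apply: eq_bigr => k1 _.
  by rewrite lE mulrDr; congr (_ + _); rewrite /GRing.scale /= mulrCA.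
move: u; apply: (tensor_ext (P := S^o) ht testS) => [x y z|x y z|a' b'].
- by rewrite mulrDl -scalerAl lE.
- rewrite scaler_sumr -big_split; apply: eq_bigr => i1 _.
  rewrite scaler_sumr -big_split; apply: eq_bigr => k1 _.
  by rewrite lE mulrDl; congr (_ + _); rewrite /GRing.scale /= mulrA.
rewrite htM.2 eE !rmorphM /= -!mulmxE !mxE big_distrlr /=.
apply: eq_bigr => i1 _; apply: eq_bigr => k1 _; rewrite !eE; exact: mulrACA.
Qed.

Lemma tensor_entry1 (htM : tensor_mul t) i k i' k' :
  tensor_entry t rho rho' i k i' k' 1 = ((i == i') && (k == k'))%:R.
Proof.
by rewrite -htM.1 (tensor_entryP _ _ _ _).2 !rmorph1 !mxE -natrM mulnb.
Qed.

End TensorEntry.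

Section Hadic.
Variable R : realType.
Local Notation C := R[i].
Local Notation K := {fps C}.

Section Module.
Variable M : lmodType K.

Lemma hdvdD N (x y : M) : hdvd N x -> hdvd N y -> hdvd N (x + y).
Proof. by move=> [x' ->] [y' ->]; exists (x' + y'); rewrite scalerDr. Qed.

Lemma hdvdN N (x : M) : hdvd N x -> hdvd N (- x).
Proof. by move=> [x' ->]; exists (- x'); rewrite scalerN. Qed.

(** All terms from index N on are divisible by the N-th power of [hbar]. This provides the limit
    chosen by [hexp]. *)
Lemma hdvd_exp_series_cauchy (a : nat -> K) (x : nat -> M) :
  hcauchy (fun n => \sum_(k < n) (a k * hbar R ^+ k) *: x k).
Proof.
set u := fun n => _.
have tail N d : hdvd N (u (N + d)%N - u N).
  elim: d => [|d IHd].
    by rewrite addn0 subrr; exists 0; rewrite scaler0.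
  rewrite addnS /u big_ord_recr /= addrAC; apply: hdvdD => //.
  exists ((a (N + d)%N * hbar R ^+ d) *: x (N + d)%N).
  by rewrite scalerA exprD; congr (_ *: _); ring.
move=> N; exists N => m n le_Nm le_Nn.
have -> : u m - u n = (u m - u N) - (u n - u N) by rewrite opprB addrA subrK.
rewrite -(subnKC le_Nm) -(subnKC le_Nn).
by apply: hdvdD; [|apply: hdvdN]; apply: tail.
Qed.

End Module.

Lemma coef_hbarXZ (f : K^o) N n :
  (hbar R ^+ N *: f)`[n] = if (n < N)%N then 0 else f`[(n - N)%N].
Proof. exact: coef_hbarXM. Qed.

Lemma hdvd_fps N (f : K^o) : hdvd N f <-> forall n, (n < N)%N -> f`[n] = 0.
Proof.
split=> [[g ->] n lt_nN|f0].
  by rewrite coef_hbarXZ lt_nN.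
exists (FPS (fun n => f`[(N + n)%N])); apply: fpsP => n.
rewrite coef_hbarXZ; case: ltnP => [/f0 //|le_Nn] /=.
by rewrite subnKC.
Qed.

(** The scalars are an admissible target for the completed tensor product, which is what lets
    [tensor_entry] be used on it. *)
Lemma hadic_fps : hadic K^o.
Proof.
split=> [f hf0|f hf|u cu].
- apply: fpsP => n; have := congr1 (fun g => g`[n.+1]) hf0.
  by rewrite -[hbar R]expr1 coef_hbarXZ subn1 !fps_coef0.
- by apply: fpsP => n; rewrite fps_coef0; apply: (hdvd_fps n.+1 f).1.
have [n0 n0P] := choice cu.
(* Coefficient [n] of the sequence no longer changes from index [n0 n.+1] on. *)
exists (FPS (fun n => (u (n0 n.+1))`[n]) : K^o) => N; exists (\max_(k < N) n0 k.+1)%N.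
move=> m le_m; apply/hdvd_fps => n lt_nN; rewrite fps_coefB /=.
apply: ((hdvd_fps n.+1 (u m - u (n0 n.+1))).1) => //; apply: n0P => //.
by apply: leq_trans le_m; apply: (@leq_bigmax _ (fun k : 'I_N => n0 k.+1) (Ordinal lt_nN)).
Qed.

(** Linearity of [rho] preserves congruence modulo powers of [hbar], so coefficient [m] of an entry
    can be read off a partial sum, where only the term of index [m] contributes. *)
Lemma rho_hexp (A : algType K) n (rho : {lrmorphism A -> 'M[K]_n.+1}) (x : A)
    (d : 'I_n.+1 -> C) : hadic A ->
  (forall i' i, rho x i' i = if i' == i then fps_const (d i) else 0) ->
  forall c i' i, rho (hexp c x) i' i = if i' == i then qpow (c * d i) else 0.
Proof.
move=> [_ _ cA] rhox c i' i.
have [s limS] := cA _ (hdvd_exp_series_cauchy (fun k => fps_const (c ^+ k / k`!%:R)) (fun k => x ^+ k)).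
have {s limS} := xgetPex 0 (ex_intro _ s limS); rewrite -/(hexp c x) /= => limS.
have rhoX k : rho (x ^+ k) i' i = if i' == i then fps_const (d i ^+ k) else 0.
  elim: k i => [|k IHk] j; first by rewrite expr0 rmorph1 mxE; case: eqP.
  rewrite exprSr rmorphM /= -mulmxE mxE (bigD1 j) //= big1 => [|l /negPf nlj].
    rewrite rhox eqxx IHk addr0; case: eqP => _; last by rewrite mul0r.
    by apply: fpsP => m; rewrite fps_coef_Mconst exprSr; case: m => //= m; rewrite mul0r.
  by rewrite rhox nlj mulr0.
(* The length [maxn n0 m.+1] makes the partial sum close enough to the limit and long enough to
   contain the term [m]. *)
apply: fpsP => m; have [n0 /(_ (maxn n0 m.+1) (leq_maxl _ _)) [y Ey]] := limS m.+1.
have /(congr1 (fun M => (rho M i' i)`[m])) := Ey.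
rewrite linearZ raddfB raddf_sum /= mxE -/(GRing.mul _ _) !mxE fps_coefD fps_coefN.
rewrite coef_hbarXM ltnSn => /eqP; rewrite subr_eq0 => /eqP <-.
rewrite summxE fps_coef_sum.
have lt_m : (m < maxn n0 m.+1)%N by rewrite leq_max ltnSn orbT.
rewrite (bigD1 (Ordinal lt_m)) //= big1 => [|k nkm].
  rewrite addr0 linearZ /= mxE rhoX; case: eqP => _; last by rewrite mulr0 fps_coef0.
  rewrite fps_coef_Mconst fps_coef_constM -[hbar R ^+ m]mulr1 coef_hbarXM ltnn subnn.
  by rewrite fps_coef1 mulr1 /= exprMn mulrAC.
rewrite linearZ /= mxE rhoX; case: eqP => _; last by rewrite mulr0 fps_coef0.
rewrite fps_coef_Mconst fps_coef_constM -[hbar R ^+ k]mulr1 coef_hbarXM fps_coef1.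
case: ltnP => le_km; first by rewrite mulr0 mul0r.
rewrite subn_eq0 leqNgt ltn_neqAle le_km -[_ == _]/(k == Ordinal lt_m) nkm.
by rewrite mulr0 mul0r.
Qed.

End Hadic.

(** * The recursion for the highest component *)

Section ClebschGordan.
Variable R : realType.
Local Notation C := R[i].
Local Notation K := {fps C}.

(** The scalar in front of the monomial in [Tbasis_h], indexed by natural numbers so that recursions
    in [i] involve no ordinals. *)
Definition Tnorm (n i : nat) : K :=
  fps_sqrt (fps_div (qpow (- (i * (n - i))%N%:R) * qfact R n) (qfact R (n - i) * qfact R i)).

(* The matrix entry of F that maps |n, i> to |n, i - 1>. *)
Definition lowering (n i : nat) : K :=
  qpow (- (i%:R - n%:R / 2)) * fps_sqrt (qnum R i * qnum R (n - i).+1).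

Lemma Tnorm_den_neq0 n i : (qfact R (n - i) * qfact R i)`[0] != 0.
Proof. by rewrite fps_coefM0 mulf_neq0 ?qfact_neq0. Qed.

Lemma Tnorm_radicand_gt0 n i :
  0 < (fps_div (qpow (- (i * (n - i))%N%:R) * qfact R n) (qfact R (n - i) * qfact R i))`[0].
Proof.
set f := fps_div _ _.
have := congr1 (fun h => h`[0]) (fps_divK (qpow (- (i * (n - i))%N%:R) * qfact R n) (Tnorm_den_neq0 n i)).
rewrite -/f !fps_coefM0 !qfact_coef0 qpow_coef0 mul1r => Ef.
have : 0 < f`[0] * ((n - i)`!%:R * i`!%:R) by rewrite Ef ltr0n fact_gt0.
by rewrite pmulr_lgt0 // mulr_gt0 // ltr0n fact_gt0.
Qed.

Lemma Tnorm_gt0 n i : 0 < (Tnorm n i)`[0].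
Proof. exact/fps_sqrt_gt0/Tnorm_radicand_gt0. Qed.

Lemma Tnorm_sqr n i : Tnorm n i * Tnorm n i * (qfact R (n - i) * qfact R i)
  = qpow (- (i * (n - i))%N%:R) * qfact R n.
Proof.
rewrite /Tnorm fps_sqrtK; first exact/fps_divK/Tnorm_den_neq0.
exact: Tnorm_radicand_gt0.
Qed.

Lemma Tnorm_coef0 n i : (i <= n)%N -> (Tnorm n i)`[0] = sqrtC 'C(n, i)%:R.
Proof.
move=> le_in; apply/eqP; rewrite -(eqrXn2 (n := 2)) //; last 2 first.
- exact/ltW/Tnorm_gt0.
- by rewrite sqrtC_ge0.
rewrite sqrtCK expr2; apply/eqP.
have := congr1 (fun h => h`[0]) (Tnorm_sqr n i).
rewrite !fps_coefM0 !qfact_coef0 qpow_coef0 mul1r -(bin_fact le_in) !natrM.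
rewrite (mulrC _ i`!%:R); apply: mulIf.
by rewrite mulf_neq0 // pnatr_eq0 -lt0n fact_gt0.
Qed.

Lemma Tnorm_max n : Tnorm n n = 1.
Proof.
apply: fps_sqr_inj; [exact: Tnorm_gt0|by rewrite fps_coef1|].
apply: (fps_mulfI (qfact_neq0 R n)).
have := Tnorm_sqr n n; rewrite subnn muln0 oppr0 qpow0 {1}/qfact big_nil !mul1r.
by rewrite mulrC mulr1.
Qed.

Lemma qnum_coef0_gt0 n : (0 < n)%N -> 0 < (qnum R n)`[0].
Proof. by rewrite qnum_coef0 ltr0n. Qed.

Lemma lowering_gt0 n i : (0 < i <= n)%N -> 0 < (lowering n i)`[0].
Proof.
case/andP=> i0 le_in; rewrite fps_coefM0 qpow_coef0 mul1r fps_sqrt_gt0 //.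
by rewrite fps_coefM0 mulr_gt0 ?qnum_coef0_gt0.
Qed.

(** The squared ratio of consecutive norms is [n-i] / [i+1] up to a power of q, and the squared
    entry of F carries [i+1] [n-i]; hence the roots combine to [n-i]. *)
Lemma Tnorm_lowering n i : (i < n)%N ->
  lowering n i.+1 * Tnorm n i.+1 = qpow (- (1 / 2)) * qnum R (n - i) * Tnorm n i.
Proof.
move=> lt_in; have n_i : (n - i = (n - i.+1).+1)%N by rewrite subnSK.
apply: fps_sqr_inj.
- by rewrite fps_coefM0 mulr_gt0 ?lowering_gt0 ?Tnorm_gt0 //= ltW.
- by rewrite !fps_coefM0 qpow_coef0 mul1r mulr_gt0 ?qnum_coef0_gt0 ?Tnorm_gt0 // subn_gt0.
apply: (fps_mulfI (Tnorm_den_neq0 n i.+1)).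
(* The identity of squares with abstract variables: [u] stands for [n-i], [v] for [i+1], [sq] for
   the root of their product, [e1], [e2], [w1], [w0] for powers of q. *)
have sqrs (A : comNzRingType) (e1 e2 w1 w0 sq u v t1 t0 q1 p0 f : A) :
    t1 * t1 * (q1 * (p0 * v)) = w1 * f -> t0 * t0 * (q1 * u * p0) = w0 * f ->
    sq * sq = v * u -> e1 * e1 * w1 = e2 * e2 * w0 ->
  q1 * (p0 * v) * (e1 * sq * t1 * (e1 * sq * t1))
  = q1 * (p0 * v) * (e2 * u * t0 * (e2 * u * t0)).
  move=> T1 T0 Esq Ew.
  transitivity (e1 * e1 * (sq * sq) * (t1 * t1 * (q1 * (p0 * v)))); first by ring.
  rewrite T1 Esq; transitivity (e1 * e1 * w1 * (v * u * f)); first by ring.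
  rewrite Ew; transitivity (e2 * e2 * (u * v) * (w0 * f)); first by ring.
  by rewrite -T0; ring.
rewrite /lowering qfactS; apply: sqrs.
- by rewrite -qfactS; apply: Tnorm_sqr.
- rewrite [in X in _ * (_ * X * _)]n_i -qfactS -n_i; exact: Tnorm_sqr.
- by rewrite n_i fps_sqrtK // fps_coefM0 mulr_gt0 ?qnum_coef0_gt0.
by rewrite -!qpowD; congr qpow; rewrite !natrM !natrB ?(ltnW lt_in) // -natr1; field.
Qed.

(* Descending induction on [i + k]: a solution of the recursion obtained by
   applying F is determined by its highest weight value. *)
Lemma lowering_recursion (a b : nat) (g : nat -> nat -> K) :
  g a b = 1 ->
  (forall i k, (i <= a)%N -> (k <= b)%N -> (i + k < a + b)%N ->
    g i k * lowering (a + b) (i + k).+1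
    = (if (i < a)%N then lowering a i.+1 * g i.+1 k else 0)
      + (if (k < b)%N then qpow (- (2 * (i%:R - a%:R / 2))) * (lowering b k.+1 * g i k.+1) else 0)) ->
  forall i k, (i <= a)%N -> (k <= b)%N ->
    g i k * Tnorm (a + b) (i + k) = Tnorm a i * Tnorm b k * qpow (- (i * (b - k))%N%:R).
Proof.
move=> gab rec i k; move: {2}(a + b - (i + k))%N (erefl (a + b - (i + k))%N) => d.
elim: d i k => [|d IHd] i k Ed le_ia le_kb.
  have [-> ->] : i = a /\ k = b by lia.
  by rewrite gab !Tnorm_max subnn muln0 oppr0 qpow0 !mulr1.
have lt_ik : (i + k < a + b)%N by lia.
(* The cancelled factor is the one that [Tnorm_lowering] produces when the index i + k of the
   component a + b is raised. *)
apply: (@fps_mulfI _ (qpow (- (1 / 2)) * qnum R (a + b - (i + k)))).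
  by rewrite fps_coefM0 qpow_coef0 mul1r gt_eqF // qnum_coef0_gt0 // subn_gt0.
transitivity (g i k * lowering (a + b) (i + k).+1 * Tnorm (a + b) (i + k).+1).
  by rewrite -mulrA Tnorm_lowering //; ring.
rewrite rec // mulrDl.
have shift (A : comNzRingType) (l t v x T y w : A) :
    l * t = v -> x * T = t * y * w -> l * x * T = v * (y * w).
  by move=> <- E; rewrite -mulrA E !mulrA.
have vanish (A : comNzRingType) (z e y w T : A) : 0 * T = z * (e * 0 * y * w).
  by rewrite mulr0 !mul0r mulr0.
(* At the boundary i = a the missing term agrees with the general formula because [0] = 0; likewise
   for k = b in [EB]. *)
have EA : (if (i < a)%N then lowering a i.+1 * g i.+1 k else 0) * Tnorm (a + b) (i + k).+1
   = qpow (- (1 / 2)) * qnum R (a - i) * Tnorm a i * (Tnorm b k * qpow (- (i.+1 * (b - k))%N%:R)).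
  case: ltnP => [lt_ia|le_ai].
    have IH := IHd i.+1 k ltac:(lia) lt_ia le_kb.
    exact: shift (Tnorm_lowering lt_ia) IH.
  have -> : (a - i = 0)%N by lia.
  by rewrite qnum0 -[RHS]mul1r; apply: vanish.
have EB : (if (k < b)%N then qpow (- (2 * (i%:R - a%:R / 2))) * (lowering b k.+1 * g i k.+1)
           else 0) * Tnorm (a + b) (i + k).+1
   = qpow (- (2 * (i%:R - a%:R / 2)))
     * (qpow (- (1 / 2)) * qnum R (b - k) * Tnorm b k * (Tnorm a i * qpow (- (i * (b - k.+1))%N%:R))).
  case: ltnP => [lt_kb|le_bk].
    have IH := IHd i k.+1 ltac:(lia) le_ia lt_kb.
    rewrite [X in _ = X * _]mulrC addnS in IH.
    by rewrite -mulrA (shift _ _ _ _ _ _ _ _ (Tnorm_lowering lt_kb) IH).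
  have -> : (b - k = 0)%N by lia.
  by rewrite qnum0; apply: vanish.
rewrite EA EB.
(* The two terms are the summands of [(a-i) + (b-k)] = [a-i] q^-(b-k) + [b-k] q^(a-i). *)
have -> : (a + b - (i + k) = (a - i) + (b - k))%N by lia.
rewrite qnumD.
have combine (A : comNzRingType) (e uA uB ta tb qa qb qc m1 m2 w : A) :
    qa = m1 * w -> uB * (qb * qc) = uB * (m2 * w) ->
  e * uA * ta * (tb * qa) + qb * (e * uB * tb * (ta * qc))
    = e * (uA * m1 + uB * m2) * (ta * tb * w).
  move=> ->; move/(congr1 (fun x => e * ta * tb * x)) => E.
  transitivity (e * uA * ta * (tb * (m1 * w)) + e * ta * tb * (uB * (qb * qc))).
    by ring.
  by rewrite E; ring.
apply: combine.
  by rewrite -qpowD; congr qpow; rewrite mulSn natrD; ring.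
(* At k = b the truncated b - (k+1) would give a wrong exponent, but the factor [0] removes the
   term. *)
have [->|lt_kb] : k = b \/ (k < b)%N by lia.
  by rewrite subnn qnum0 !mul0r.
rewrite -!qpowD; congr (_ * qpow _).
rewrite !natrM !natrB // -natr1; by field.
Qed.

End ClebschGordan.

Lemma cg_range_max a b : cg_range a b (a + b).
Proof. by rewrite /cg_range leqnn andbT addnn odd_double andbT; lia. Qed.

(** * Coefficients of the component j1 + j2 and the structure constants of both planes *)

Section HighestComponent.
Variable R : realType.
Local Notation C := R[i].
Local Notation K := {fps C}.
Variables (Uh : algType K) (Eh Hh Fh : Uh) (UUh : algType K) (th : Uh -> Uh -> UUh).
Variables (Deltah : {lrmorphism Uh -> UUh}) (rhoh : forall n, {lrmorphism Uh -> 'M[K]_n.+1}).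
Variables (c : cg_coef C) (cq : cg_coef K).
Hypotheses (hUh : hadic Uh) (hth : completed_tensor_product th).
Hypothesis hDeltah : is_coproduct_h th Eh Hh Fh Deltah.
Hypothesis hrhoh : is_spin_rep_h Eh Hh Fh rhoh.
Hypothesis hcq : is_qCG th Deltah rhoh c cq.
Hypothesis c_gt0 : forall a b, 0 < c (ord_max : 'I_a.+1) (ord_max : 'I_b.+1) (ord_max : 'I_(a + b).+1).

Lemma sum_tensor_entryD a b (u v : UUh) i k (X : 'I_a.+1 -> 'I_b.+1 -> K) :
  \sum_i' \sum_k' tensor_entry th (rhoh a) (rhoh b) i k i' k' (u + v) * X i' k'
  = \sum_i' \sum_k' tensor_entry th (rhoh a) (rhoh b) i k i' k' u * X i' k'
    + \sum_i' \sum_k' tensor_entry th (rhoh a) (rhoh b) i k i' k' v * X i' k'.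
Proof.
rewrite -big_split; apply: eq_bigr => i' _; rewrite -big_split; apply: eq_bigr => k' _.
have [lE _] := tensor_entryP hth.2 (@hadic_fps R) (rhoh a) (rhoh b) i k i' k'.
by rewrite (linear_funD lE) mulrDl.
Qed.

Lemma sum_tensor_entry a b (x y : Uh) i k (X : 'I_a.+1 -> 'I_b.+1 -> K) :
  \sum_i' \sum_k' tensor_entry th (rhoh a) (rhoh b) i k i' k' (th x y) * X i' k'
  = \sum_i' rhoh a x i i' * \sum_k' rhoh b y k k' * X i' k'.
Proof.
apply: eq_bigr => i' _; rewrite mulr_sumr; apply: eq_bigr => k' _.
by rewrite (tensor_entryP hth.2 (@hadic_fps R) _ _ _ _ _ _).2 mulrA.
Qed.

Lemma sum_diag_row n (M : 'M[K]_n.+1) (d : 'I_n.+1 -> K) (i : 'I_n.+1) (Y : 'I_n.+1 -> K) :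
  (forall i' i, M i' i = if i' == i then d i else 0) ->
  \sum_i' M i i' * Y i' = d i * Y i.
Proof.
move=> EM; rewrite (bigD1 i) //= EM eqxx big1 ?addr0 // => i' /negPf ni.
by rewrite EM eq_sym ni mul0r.
Qed.

Lemma sum_row1 n (i : 'I_n.+1) (Y : 'I_n.+1 -> K) : \sum_i' rhoh n 1 i i' * Y i' = Y i.
Proof.
rewrite (sum_diag_row (d := fun=> 1)) ?mul1r // => i' j.
by rewrite rmorph1 mxE; case: eqP.
Qed.

Lemma rhohH n (i' i : 'I_n.+1) :
  rhoh n Hh i' i = if i' == i then fps_const (2 * mag R i) else 0.
Proof. by have [] := hrhoh i' i. Qed.

Lemma sum_rowF n (i : 'I_n.+1) (Y : 'I_n.+1 -> K) :
  \sum_i' rhoh n Fh i i' * Y i'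
  = if (i < n)%N then lowering R n i.+1 * Y (inord i.+1) else 0.
Proof.
have EF i' : rhoh n Fh i i' = if i.+1 == i' :> nat then lowering R n i' else 0.
  by have [_ -> _] := hrhoh i i'.
case: ltnP => [lt_in|le_ni]; last first.
  by rewrite big1 // => i' _; rewrite EF; case: eqP => [E|_]; rewrite ?mul0r //; have := ltn_ord i'; lia.
rewrite (bigD1 (inord i.+1)) //= EF inordK // eqxx big1 ?addr0 // => i' ni'.
rewrite EF; case: eqP => [E|_]; last by rewrite mul0r.
by case/eqP: ni'; apply: val_inj; rewrite /= inordK.
Qed.

(** Intertwining H multiplies the coefficient by the difference of two weights, a nonzero constant
    unless i + k = l. *)
Lemma qCG_weight a b (i : 'I_a.+1) (k : 'I_b.+1) (l : 'I_(a + b).+1) :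
  (i + k)%N != l -> cq i k l = 0.
Proof.
move=> nl; have [intw _ _ _] := hcq.
have [_ EH _] := hDeltah.
have := intw a b (a + b)%N (cg_range_max a b) Hh i k l.
rewrite EH sum_tensor_entryD !sum_tensor_entry sum_row1 (sum_diag_row _ _ (rhohH (n := a))) sum_row1.
rewrite (sum_diag_row _ _ (rhohH (n := b))).
rewrite (bigD1 l) //= big1 => [|l' /negPf nl']; last by rewrite rhohH nl' mulr0.
rewrite rhohH eqxx addr0 [in RHS]mulrC -mulrDl => /eqP; rewrite -subr_eq0 -mulrBl => /eqP.
apply: fps_lreg; rewrite fps_coefB fps_coefD /= /mag natrD.
have -> : 2 * (i%:R - a%:R / 2) + 2 * (k%:R - b%:R / 2) - 2 * (l%:R - (a%:R + b%:R) / 2)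
   = 2 * ((i + k)%:R - l%:R) :> C by rewrite natrD; by field.
by rewrite mulf_neq0 ?pnatr_eq0 ?subr_eq0 ?eqr_nat.
Qed.

(** Weight conservation leaves a single term in the normalization sum, so the square is 1; the
    positive classical limit excludes -1. *)
Lemma qCG_highest a b :
  cq (ord_max : 'I_a.+1) (ord_max : 'I_b.+1) (ord_max : 'I_(a + b).+1) = 1.
Proof.
have [_ [orth _] _ lim] := hcq.
apply: fps_sqr_inj; [by rewrite lim ?cg_range_max|by rewrite fps_coef1|].
rewrite mulr1; have := orth a b (a + b)%N (a + b)%N ord_max ord_max (cg_range_max a b) (cg_range_max a b).
rewrite !eqxx (bigD1 ord_max) //= (bigD1 ord_max) //= big1 => [|k nk]; last first.
  rewrite qCG_weight ?mul0r //= eqn_add2l.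
  by apply: contra nk => /eqP E; apply/eqP/val_inj.
rewrite big1 ?addr0 // => i ni; rewrite big1 // => k _.
rewrite qCG_weight ?mul0r //=; have := ltn_ord i; have := ltn_ord k.
have : i != a :> nat by apply: contra ni => /eqP E; apply/eqP/val_inj.
by lia.
Qed.

Lemma qCG_Tnorm a b (i : 'I_a.+1) (k : 'I_b.+1) :
  cq i k (inord (i + k) : 'I_(a + b).+1) * Tnorm R (a + b) (i + k)
  = Tnorm R a i * Tnorm R b k * qpow (- (i * (b - k))%N%:R).
Proof.
(* The recursion runs over natural numbers; [inord] is only evaluated at indices in range. *)
pose g i k := cq (inord i : 'I_a.+1) (inord k : 'I_b.+1) (inord (i + k) : 'I_(a + b).+1).
have le_ia : (i <= a)%N by rewrite -ltnS.
have le_kb : (k <= b)%N by rewrite -ltnS.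
rewrite -(lowering_recursion (g := g)) //; first by rewrite /g !inord_val.
  rewrite /g -[in RHS](qCG_highest a b).
  by congr cq; apply: val_inj; rewrite /= inordK.
move=> {le_ia le_kb k i} i k le_ia le_kb lt_ik.
have [intw _ _ _] := hcq; have [_ _ EF] := hDeltah.
have := intw a b (a + b)%N (cg_range_max a b) Fh (inord i) (inord k) (inord (i + k).+1).
rewrite EF sum_tensor_entryD !sum_tensor_entry.
(* The factor e^(-hH) in the coproduct of F is diagonal and yields the power of q in the second term
   of the recursion. *)
have Eexp n := rho_hexp hUh (rhohH (n := n)) (- 1).
rewrite sum_rowF (sum_diag_row _ _ (Eexp a)) sum_rowF sum_row1 !inordK // => E.
rewrite {1}/g; transitivity (\sum_(l' < (a + b).+1)
  cq (inord i : 'I_a.+1) (inord k : 'I_b.+1) l' * rhoh (a + b) Fh l' (inord (i + k).+1)).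
  rewrite (bigD1 (inord (i + k))) //= big1 ?addr0 => [|l' nl'].
    have [_ -> _] := hrhoh (inord (i + k) : 'I_(a + b).+1) (inord (i + k).+1).
    by rewrite /mag !inordK ?eqxx //; lia.
  have [_ -> _] := hrhoh l' (inord (i + k).+1).
  rewrite inordK // eqSS ifF ?mulr0 //.
  by apply: contraNF nl' => /eqP E'; apply/eqP/val_inj; rewrite /= E' inordK //; lia.
rewrite -E /g /mag inordK // addSn addnS mulN1r; congr (_ + _).
by case: ifP; rewrite ?mulr0.
Qed.

Lemma qCG_coef0 a b (i : 'I_a.+1) (k : 'I_b.+1) (l : 'I_(a + b).+1) :
  (cq i k l)`[0] = c i k l.
Proof. by have [_ _ _ ->] := hcq; rewrite ?cg_range_max. Qed.

Lemma CG_weight a b (i : 'I_a.+1) (k : 'I_b.+1) (l : 'I_(a + b).+1) :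
  (i + k)%N != l -> c i k l = 0.
Proof. by move=> nl; rewrite -qCG_coef0 qCG_weight // fps_coef0. Qed.

(** This is the constant term in [hbar] of [qCG_Tnorm], where the norms become roots of binomial
    coefficients. *)
Lemma Tbasis_mul a b (i : 'I_a.+1) (k : 'I_b.+1) :
  Tbasis R i * Tbasis R k
  = c i k (inord (i + k) : 'I_(a + b).+1) *: Tbasis R (inord (i + k) : 'I_(a + b).+1).
Proof.
have le_ia : (i <= a)%N by rewrite -ltnS.
have le_kb : (k <= b)%N by rewrite -ltnS.
have := congr1 (fun f => f`[0]) (qCG_Tnorm i k).
rewrite !fps_coefM0 qCG_coef0 qpow_coef0 mulr1 !Tnorm_coef0 ?leq_add // => E.
rewrite /Tbasis scalerA inordK ?ltnS ?leq_add // E.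
rewrite -scalerAl -scalerAr scalerA; congr (_ *: _).
by rewrite mulrACA -!exprD; congr (_ ^+ _ * _); lia.
Qed.

Lemma quantum_plane_comm (X : algType K) (xm xp : X) : xm * xp = qpow 1 *: (xp * xm) ->
  forall i j, xp ^+ i * xm ^+ j = qpow (- (i * j)%N%:R) *: (xm ^+ j * xp ^+ i).
Proof.
move=> xmxp.
have xpxm : xp * xm = qpow (- 1) *: (xm * xp).
  by rewrite xmxp scalerA -qpowD addNr qpow0 scale1r.
have xpX j : xp * xm ^+ j = qpow (- j%:R) *: (xm ^+ j * xp).
  elim: j => [|j IHj]; first by rewrite oppr0 qpow0 scale1r !expr0 mulr1 mul1r.
  rewrite exprSr mulrA IHj -scalerAl -(mulrA _ xp) xpxm -scalerAr scalerA -qpowD mulrA.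
  by rewrite -natr1 opprD.
elim=> [|i IHi] j; first by rewrite mul0n oppr0 qpow0 scale1r !expr0 mulr1 mul1r.
rewrite exprS -mulrA IHi -scalerAr (mulrA xp) xpX -scalerAl scalerA -qpowD -(mulrA _ xp).
by rewrite mulSn natrD opprD addrC.
Qed.

(** Reordering x_+^i past x_-^(b-k) costs exactly the power of q that appears in [qCG_Tnorm]. *)
Lemma Tbasis_h_mul (X : algType K) (xm xp : X) : xm * xp = qpow 1 *: (xp * xm) ->
  forall a b (i : 'I_a.+1) (k : 'I_b.+1),
  Tbasis_h xm xp i * Tbasis_h xm xp k
  = cq i k (inord (i + k) : 'I_(a + b).+1) *: Tbasis_h xm xp (inord (i + k) : 'I_(a + b).+1).
Proof.
move=> /quantum_plane_comm comm a b i k.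
have le_ia : (i <= a)%N by rewrite -ltnS.
have le_kb : (k <= b)%N by rewrite -ltnS.
have E n (j : 'I_n.+1) : Tbasis_h xm xp j = Tnorm R n j *: (xm ^+ (n - j) * xp ^+ j) by [].
rewrite !E scalerA inordK ?ltnS ?leq_add // qCG_Tnorm.
rewrite -scalerAl -scalerAr scalerA -(mulrA (xm ^+ _)) (mulrA (xp ^+ _)) comm.
rewrite -scalerAl -scalerAr scalerA -(mulrA (xm ^+ _)) -exprD mulrA -exprD.
by congr (_ *: (_ ^+ _ * _)); lia.
Qed.

End HighestComponent.

(** * Extension from the basis vectors *)

Lemma bilinear_biadditive (S : comNzRingType) (V W P : lmodType S) (b : V -> W -> P) :
  bilinear b -> biadditive b.
Proof.
by move=> [br bl]; split=> [v|w] x y; [exact: linear_funD (br v) x y|exact: linear_funD (bl w) x y].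
Qed.

Section FpsLinear.
Variables (S : comNzRingType) (V W P : lmodType S).

Lemma fps_map_linear (f : V -> W) : linear f -> linear (fps_map f).
Proof.
move=> lf c x y; apply: fpsP => n; rewrite fps_coefD /= (linear_funD lf) (linear_fun_sum lf).
by congr (_ + _); apply: eq_bigr => i _; rewrite (linear_funZ lf).
Qed.

Lemma fps_map_const (f : V -> W) v : f 0 = 0 -> fps_map f (fps_const v) = fps_const (f v).
Proof. by move=> f0; apply: fpsP => -[]. Qed.

Lemma fps_bilin_linearl (b : V -> W -> P) g : bilinear b -> linear (fps_bilin b ^~ g).
Proof.
move=> bb c x y; have hb := bilinear_biadditive bb.
rewrite (fps_bilinDl hb) -(fps_bilinA hb (scale_biadditive P) (b23 := b) (b12 := *:%R)) //.
by move=> s v w; rewrite (linear_funZ (bb.2 w)).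
Qed.

End FpsLinear.

Lemma fps_bilin_flip (V W P : zmodType) (b : V -> W -> P) f g :
  fps_bilin b f g = fps_bilin (fun w v => b v w) g f.
Proof.
apply: fpsP => n /=; rewrite (reindex_inj rev_ord_inj) /=; apply: eq_bigr => i _.
by rewrite subSS (subKn (ltnSE (ltn_ord i))).
Qed.

Lemma fps_bilin_linearr (S : comNzRingType) (V W P : lmodType S) (b : V -> W -> P) f :
  bilinear b -> linear (fps_bilin b f).
Proof.
move=> [br bl] c x y; rewrite !(fps_bilin_flip b f).
by apply: (fps_bilin_linearl (b := fun w v => b v w)).
Qed.

Section Extensionality.
Variable R : realType.
Local Notation C := R[i].
Local Notation K := {fps C}.
Local Notation X := {mpoly C[2]}.

(** Writing x = h y + x_0, coefficient n of the image of x depends only on coefficient n - 1 of the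
    image of y and on the image of a constant, so induction on n applies. *)
Lemma fps_linear_ext (V P : lmodType C) (f g : {fps V} -> {fps P}) :
  linear f -> linear g -> (forall v, f (fps_const v) = g (fps_const v)) -> f =1 g.
Proof.
move=> lf lg Efg x; apply: fpsP => n; elim: n x => [|n IHn] x.
all: pose y : {fps V} := FPS (fun n => x`[n.+1]).
all: have -> : x = hbar R *: y + fps_const x`[0]
  by apply: fpsP => -[|m]; rewrite fps_coefD coef_hbarZ /= (add0r, addr0).
all: rewrite lf lg Efg !fps_coefD !coef_hbarZ //.
by rewrite IHn.
Qed.

Lemma mpolyX_Tbasis (m : 'X_{1..2}) :
  exists (n : nat) (i : 'I_n.+1) (s : C), 'X_[m] = s *: Tbasis R i :> X.
Proof.
exists (m ord0 + m ord_max)%N, (inord (m ord_max)).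
have lt_m : (m ord_max < (m ord0 + m ord_max).+1)%N by rewrite ltnS leq_addl.
exists (sqrtC ('C(m ord0 + m ord_max, m ord_max))%:R)^-1.
rewrite /Tbasis inordK // scalerA mulVf ?scale1r; last first.
  by rewrite sqrtC_eq0 pnatr_eq0 -lt0n bin_gt0 leq_addl.
rewrite addnK mpolyXE_id big_ord_recl big_ord1; congr (_ * 'X_ _ ^+ m _).
by apply: val_inj.
Qed.

Lemma Tbasis_linear_ext (P : lmodType C) (f g : {fps X} -> {fps P}) :
  linear f -> linear g ->
  (forall n (i : 'I_n.+1), f (fps_const (Tbasis R i)) = g (fps_const (Tbasis R i))) ->
  f =1 g.
Proof.
move=> lf lg Efg; apply: fps_linear_ext => // p.
have constS := big_morph (@fps_const X) (@fps_constD C X) (erefl : fps_const 0 = 0).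
rewrite [p]mpolyE constS !(linear_fun_sum lf, linear_fun_sum lg); apply: eq_bigr => m _.
have [n [i [s ->]]] := mpolyX_Tbasis m.
rewrite 2!fps_constZ 2!(linear_funZ lf) 2!(linear_funZ lg).
by congr (_ *: (_ *: _)); apply: Efg.
Qed.

End Extensionality.

(** * The action on the tensor square, and the matrix of the inverse twist *)

Section Action.
Variable R : realType.
Local Notation C := R[i].
Local Notation X := {mpoly C[2]}.
Variables (U UU : algType C) (t : U -> U -> UU) (ht : tensor_product t).
Variables (act : U -> X -> X) (hact : bilinear act).
Variables (XX : lmodType C) (tX : X -> X -> XX) (htX : tensor_product tX).

(** Two nested lifts are unfolded: [L a b] is the inner one on the tensor square of the plane.
    Uniqueness there makes it bilinear in [a] and [b], so the outer lift exists; uniqueness of the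
    latter gives linearity in [w]. *)
Lemma tensor_actionP :
  bilinear (tensor_action t act tX : UU -> XX -> XX) /\
  forall a b x y, tensor_action t act tX (t a b) (tX x y) = tX (act a x) (act b y).
Proof.
have [tXr tXl] := htX.1; have [actr actl] := hact.
pose L a b := tensor_lift tX (fun x y => tX (act a x) (act b y)).
have LP a b : linear (L a b) /\ forall x y, L a b (tX x y) = tX (act a x) (act b y).
  apply: (tensor_liftP htX) => //.
  by split=> [x|y] s v w; rewrite actr (tXr, tXl).
have lcomb a b a' b' s : linear (fun w => s *: L a b w + L a' b' w).
  move=> r v w; rewrite (LP a b).1 (LP a' b').1 !scalerDr !scalerA (mulrC r).
  by rewrite addrACA.
have Lb w : bilinear (fun a b => L a b w).
  split=> [a s b b'|b s a a'].
    apply: (tensor_ext htX I (LP _ _).1 (lcomb a b a b' s)) => x y.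
    by rewrite !(LP _ _).2 actl tXr.
  apply: (tensor_ext htX I (LP _ _).1 (lcomb a b a' b s)) => x y.
  by rewrite !(LP _ _).2 actl tXl.
have TP w : linear ((tensor_action t act tX)^~ w) /\
    forall a b, tensor_action t act tX (t a b) w = L a b w.
  exact: (tensor_liftP ht I (Lb w)).
split=> [|a b x y]; last by rewrite (TP _).2 (LP _ _).2.
split=> [u s v w|w]; last exact: (TP w).1.
have l2 : linear (fun u => s *: tensor_action t act tX u v + tensor_action t act tX u w).
  move=> r u1 u2; rewrite (TP v).1 (TP w).1 !scalerDr !scalerA (mulrC r).
  by rewrite addrACA.
apply: (tensor_ext ht I (TP _).1 l2) => a b /=.
by rewrite !(TP _).2 (LP _ _).1.
Qed.

Lemma tensor_action_Tbasis (rho : forall n, {lrmorphism U -> 'M[C]_n.+1})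
    (hrho : forall g n (i : 'I_n.+1), act g (Tbasis R i) = \sum_i' rho n g i' i *: Tbasis R i')
    a b (i : 'I_a.+1) (k : 'I_b.+1) u :
  tensor_action t act tX u (tX (Tbasis R i) (Tbasis R k))
  = \sum_i' \sum_k' tensor_entry t (rho a) (rho b) i' k' i k u
                    *: tX (Tbasis R i') (Tbasis R k').
Proof.
have [tXr tXl] := htX.1; have [[_ TAl] TAE] := tensor_actionP.
have eP i' k' := tensor_entryP ht I (rho a) (rho b) i' k' i k.
move: u; apply: (tensor_ext ht I (TAl _)) => [s u v|x y].
  rewrite scaler_sumr -big_split; apply: eq_bigr => i' _.
  rewrite scaler_sumr -big_split; apply: eq_bigr => k' _ /=.
  by rewrite (eP i' k').1 scalerDl -scalerA.
rewrite TAE !hrho (linear_fun_sum (tXl _)); apply: eq_bigr => i' _.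
rewrite (linear_funZ (tXl _)) (linear_fun_sum (tXr _)) scaler_sumr; apply: eq_bigr => k' _.
by rewrite (linear_funZ (tXr _)) scalerA (eP i' k').2.
Qed.

Lemma plane_mulP :
  linear (plane_mul tX) /\ forall x y, plane_mul tX (tX x y) = x * y.
Proof.
apply: (tensor_liftP htX) => //; split=> [x|y] s v w; first by rewrite mulrDr scalerAr.
by rewrite mulrDl scalerAl.
Qed.

End Action.

(* With Q and C the two coefficient matrices and V the matrix of the inverse
   twist, Q C^T V = 1 and Q^T Q = 1 give C^T V = Q^T. *)
Lemma inverse_twist_matrix (R : realType) (c : cg_coef R[i]) (cq : cg_coef {fps R[i]}) a b
    (M V : 'I_a.+1 -> 'I_b.+1 -> 'I_a.+1 -> 'I_b.+1 -> {fps R[i]}) :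
  cg_orthogonal cq ->
  (forall i k i' k', M i k i' k' = \sum_(n < (a + b).+1 | cg_range a b n) \sum_(l < n.+1)
        cq a b n i k l * fps_const (c a b n i' k' l)) ->
  (forall i k i' k', \sum_i1 \sum_k1 M i k i1 k1 * V i1 k1 i' k'
     = ((i == i') && (k == k'))%:R) ->
  forall i k (l : 'I_(a + b).+1),
    \sum_i' \sum_k' fps_const (c a b (a + b)%N i' k' l) * V i' k' i k = cq a b (a + b)%N i k l.
Proof.
move=> [orth _] EM MV i k L.
pose Y n (l : 'I_n.+1) := \sum_i' \sum_k' fps_const (c a b n i' k' l) * V i' k' i k.
(* The identity Q C^T V = 1 is inserted after the row [L] of Q^T. *)
have -> : cq a b (a + b)%N i k L = \sum_i1 \sum_k1 cq a b (a + b)%N i1 k1 L *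
    \sum_i' \sum_k' M i1 k1 i' k' * V i' k' i k.
  rewrite (bigD1 i) //= (bigD1 k) //= MV !eqxx mulr1 !big1 ?addr0 // => [i1 ni|k1 nk].
    by rewrite big1 // => k1 _; rewrite MV (negPf ni) mulr0.
  by rewrite MV eqxx (negPf nk) mulr0.
(* Grouped as (Q^T Q)(C^T V), orthogonality of the columns of Q keeps only n = a + b and l = [L];
   the remaining steps interchange sums. *)
transitivity (\sum_(n < (a + b).+1 | cg_range a b n) \sum_(l < n.+1)
    (\sum_i1 \sum_k1 cq a b (a + b)%N i1 k1 L * cq a b n i1 k1 l) * Y n l).
  rewrite (bigD1 ord_max (cg_range_max a b)) /=.
  rewrite [X in _ + X]big1 ?addr0 => [|n /andP[rn nmax]]; last first.
    rewrite big1 // => l _; rewrite orth ?cg_range_max //.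
    have -> : ((a + b)%N == n) = false.
      by apply: contraNF nmax => /eqP E; apply/eqP/val_inj.
    by rewrite mul0r.
  rewrite (bigD1 L) //= orth ?cg_range_max // !eqxx mul1r [X in _ + X]big1 ?addr0 // => l nl.
  rewrite orth ?cg_range_max // eqxx (_ : (L == l :> nat) = false) ?mul0r //.
  by apply: contraNF nl => /eqP E; apply/eqP/val_inj.
transitivity (\sum_(n < (a + b).+1 | cg_range a b n) \sum_i1 \sum_k1 \sum_(l < n.+1)
    cq a b (a + b)%N i1 k1 L * (cq a b n i1 k1 l * Y n l)).
  apply: eq_bigr => n _.
  transitivity (\sum_(l < n.+1) \sum_i1 \sum_k1
      cq a b (a + b)%N i1 k1 L * (cq a b n i1 k1 l * Y n l)).
    apply: eq_bigr => l _; rewrite mulr_suml; apply: eq_bigr => i1 _.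
    by rewrite mulr_suml; apply: eq_bigr => k1 _; rewrite -mulrA.
  by rewrite exchange_big; apply: eq_bigr => i1 _; apply: exchange_big.
rewrite exchange_big; apply: eq_bigr => i1 _; rewrite exchange_big; apply: eq_bigr => k1 _.
transitivity (\sum_(n < (a + b).+1 | cg_range a b n) cq a b (a + b)%N i1 k1 L *
    \sum_(l < n.+1) cq a b n i1 k1 l * Y n l).
  by apply: eq_bigr => n _; rewrite mulr_sumr.
rewrite -!mulr_sumr; congr (_ * _).
transitivity (\sum_(n < (a + b).+1 | cg_range a b n) \sum_i' \sum_k' \sum_(l < n.+1)
    cq a b n i1 k1 l * fps_const (c a b n i' k' l) * V i' k' i k).
  apply: eq_bigr => n _.
  transitivity (\sum_(l < n.+1) \sum_i' \sum_k'
      cq a b n i1 k1 l * fps_const (c a b n i' k' l) * V i' k' i k).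
    apply: eq_bigr => l _; rewrite mulr_sumr; apply: eq_bigr => i' _.
    by rewrite mulr_sumr; apply: eq_bigr => k' _; rewrite mulrA.
  by rewrite exchange_big; apply: eq_bigr => i' _; apply: exchange_big.
rewrite exchange_big; apply: eq_bigr => i' _; rewrite exchange_big; apply: eq_bigr => k' _.
rewrite EM mulr_suml; apply: eq_bigr => n _; by rewrite mulr_suml.
Qed.

Lemma fps_tensor_entryM (S : comNzRingType) (A AA : algType S) (t : A -> A -> AA)
    (ht : tensor_product t) (htM : tensor_mul t) m n
    (rho : {lrmorphism A -> 'M[S]_m.+1}) (rho' : {lrmorphism A -> 'M[S]_n.+1})
    i k i' k' (f g : {fps AA}) :
  fps_map (tensor_entry t rho rho' i k i' k') (f * g)
  = \sum_i1 \sum_k1 fps_map (tensor_entry t rho rho' i k i1 k1) f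
                    * fps_map (tensor_entry t rho rho' i1 k1 i' k') g.
Proof.
apply: fpsP => s; rewrite fps_coef_sum /=.
rewrite (linear_fun_sum (tensor_entryP ht I rho rho' i k i' k').1).
transitivity (\sum_(j < s.+1) \sum_i1 \sum_k1
    tensor_entry t rho rho' i k i1 k1 f`[j] * tensor_entry t rho rho' i1 k1 i' k' g`[(s - j)%N]).
  by apply: eq_bigr => j _; apply: (tensor_entryM ht I).
rewrite exchange_big /=; apply: eq_bigr => i1 _.
by rewrite fps_coef_sum exchange_big.
Qed.

(** * Comparison of the deformed product with the twisted product *)

Theorem proposition8 (R : realType)
  (* U(su_2) with its coproduct, counit, involution and representations *)
  (U : algType R[i]) (E H F : U) (hU : is_Usu2 E H F)
  (UU : algType R[i]) (t : U -> U -> UU) (ht : tensor_product t) (htM : tensor_mul t)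
  (Delta : {lrmorphism U -> UU}) (hDelta : is_coproduct t E H F Delta)
  (eps : {lrmorphism U -> R[i]}) (heps : [/\ eps E = 0, eps H = 0 & eps F = 0])
  (star : U -> U) (hstar : is_star E H F star)
  (rho : forall n, {lrmorphism U -> 'M[R[i]]_n.+1}) (hrho : is_spin_rep E H F rho)
  (* U_h(su_2) with its coproduct, involution and representations *)
  (Uh : algType {fps R[i]}) (Eh Hh Fh : Uh) (hUh : is_Uhsu2 Eh Hh Fh)
  (UUh : algType {fps R[i]}) (th : Uh -> Uh -> UUh)
  (hth : completed_tensor_product th) (hthM : tensor_mul th)
  (Deltah : {lrmorphism Uh -> UUh}) (hDeltah : is_coproduct_h th Eh Hh Fh Deltah)
  (starh : Uh -> Uh) (hstarh : is_star_h Eh Hh Fh starh)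
  (rhoh : forall n, {lrmorphism Uh -> 'M[{fps R[i]}]_n.+1})
  (hrhoh : is_spin_rep_h Eh Hh Fh rhoh)
  (* the isomorphism alpha *)
  (alpha : {lrmorphism Uh -> {fps U}}) (alphaV : {fps U} -> Uh)
  (alphaK : cancel alpha alphaV) (alphaVK : cancel alphaV alpha)
  (halpha : is_alpha E H F star rho Eh Hh Fh starh rhoh alpha)
  (* the Clebsch-Gordan coefficients *)
  (c : cg_coef R[i]) (hc : is_CG t Delta rho c)
  (cq : cg_coef {fps R[i]}) (hcq : is_qCG th Deltah rhoh c cq)
  (* the standard twist *)
  (Fs FsV : {fps UU})
  (hFs : is_Drinfeld_twist t Delta eps (Delta_hbar t th Deltah alpha alphaV) Fs FsV)
  (hFsE : standard_matrix t rho c cq Fs)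
  (* the quantum plane *)
  (Xh : algType {fps R[i]}) (xm xp : Xh) (hXh : is_quantum_plane xm xp)
  (* the tensor square of C[x_-, x_+] and the action of U(su_2) *)
  (XX : lmodType R[i]) (tX : {mpoly R[i][2]} -> {mpoly R[i][2]} -> XX)
  (htX : tensor_product tX)
  (act : U -> {mpoly R[i][2]} -> {mpoly R[i][2]}) (hact : is_plane_action rho act)
  (* the identification of the quantum plane with C[x_-, x_+][[h]] *)
  (phi : {linear Xh -> {fps {mpoly R[i][2]}}}) (phiV : {fps {mpoly R[i][2]}} -> Xh)
  (phiK : cancel phi phiV) (phiVK : cancel phiV phi)
  (hphi : forall n (i : 'I_n.+1), phi (Tbasis_h xm xp i) = fps_const (Tbasis R i)) :
  forall x y : {fps {mpoly R[i][2]}},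
    phi (phiV x * phiV y)
    = fps_map (plane_mul tX)
        (fps_bilin (tensor_action t act tX) FsV (fps_bilin tX x y)).
Proof.
have [hadicUh _ _] := hUh.
(* For n = a + b the sign convention concerns 2k = b + n - a = 2b, that is, the maximal [k]. *)
have c_gt0 a b : 0 < c a b (a + b)%N ord_max ord_max ord_max.
  have [_ _ _ pos] := hc; apply: pos; first exact: cg_range_max.
  by rewrite -addnn /=; lia.
have [_ xmxp _] := hXh; have [bact actT] := hact.
have [[TAr TAl] _] := tensor_actionP ht bact htX.
have [PMl PME] := plane_mulP htX.
have phiVl : linear phiV.
  by move=> s u v; apply: (can_inj phiK); rewrite linearP !phiVK.
have phiVT n (i : 'I_n.+1) : phiV (fps_const (Tbasis R i)) = Tbasis_h xm xp i.
  by rewrite -hphi phiK.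
have [FsK _ _ _ _] := hFs.
pose rhs x y := fps_map (plane_mul tX)
  (fps_bilin (tensor_action t act tX) FsV (fps_bilin tX x y)).
have rhsr x : linear (rhs x).
  move=> s u v; rewrite /rhs (fps_bilin_linearr _ htX.1) (fps_bilin_linearr _ (conj TAr TAl)).
  exact: (fps_map_linear PMl).
have rhsl y : linear (rhs ^~ y).
  move=> s u v; rewrite /rhs (fps_bilin_linearl _ htX.1) (fps_bilin_linearr _ (conj TAr TAl)).
  exact: (fps_map_linear PMl).
move=> x y; rewrite -/(rhs x y).
move: x; apply: (Tbasis_linear_ext _ (rhsl y)) => [s u v|a i].
  by rewrite phiVl mulrDl -scalerAl linearP.
move: y; apply: (Tbasis_linear_ext _ (rhsr _)) => [s u v|b k].
  by rewrite phiVl mulrDr -scalerAr linearP.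
rewrite !phiVT (Tbasis_h_mul hadicUh hth hDeltah hrhoh hcq c_gt0 xmxp) linearZ /= hphi.
rewrite /rhs (fps_bilin_constl (bilinear_biadditive htX.1)).
rewrite fps_map_const; last exact: (biadd0r (bilinear_biadditive htX.1)).
rewrite (fps_bilin_constr (bilinear_biadditive (conj TAr TAl))).
(* The arguments are now constants in h, so the coefficient at [s] involves only the coefficient of
   [FsV] at [s]. *)
apply: fpsP => s; rewrite fps_scale_const /=.
rewrite (tensor_action_Tbasis ht bact htX actT) (linear_fun_sum PMl).
pose V i' k' i k := fps_map (tensor_entry t (rho a) (rho b) i' k' i k) FsV.
have CV : forall i k l, \sum_i' \sum_k' fps_const (c a b (a + b)%N i' k' l) * V i' k' i k
    = cq a b (a + b)%N i k l.
  have [_ orth _ _] := hcq.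
  pose M i1 k1 i' k' := fps_map (tensor_entry t (rho a) (rho b) i1 k1 i' k') Fs.
  apply: (inverse_twist_matrix (M := M) orth (fun i k i' k' => hFsE a b i i' k k')) => i1 k1 i2 k2.
  rewrite -(fps_tensor_entryM ht htM) FsK.
  have [el _] := tensor_entryP ht I (rho a) (rho b) i1 k1 i2 k2.
  have e1 := tensor_entry1 ht I (rho a) (rho b) htM i1 k1 i2 k2.
  rewrite (fps_map_const _ (linear_fun0 el)) e1.
  by case: (_ && _) => //; apply: fpsP => -[].
have Tweight (d : 'I_(a + b).+1 -> R[i]) (l0 : 'I_(a + b).+1) :
    (forall l : 'I_(a + b).+1, l != l0 -> d l = 0) ->
    \sum_l d l *: Tbasis R l = d l0 *: Tbasis R l0.
  move=> d0; rewrite (bigD1 l0) //= big1 ?addr0 // => l /d0 ->; exact: scale0r.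
(* The single term of weight i + k is expanded to a sum over all [l] so that [CV] applies; after the
   sums are exchanged, [CG_weight] contracts the sum over [l] to the weight i' + k', as in the
   undeformed product. *)
transitivity (\sum_(l < (a + b).+1) (cq a b (a + b)%N i k l)`[s] *: Tbasis R l).
  rewrite (Tweight _ (inord (i + k))) // => l nl.
  rewrite (qCG_weight hth hDeltah hrhoh hcq) ?fps_coef0 //.
  apply: contraNneq nl => E0; apply/eqP/val_inj; rewrite /= inordK E0 //.
under eq_bigr => l _ do rewrite -CV fps_coef_sum scaler_suml.
rewrite exchange_big; apply: eq_bigr => i' _.
under eq_bigr => l _ do rewrite fps_coef_sum scaler_suml.
rewrite exchange_big (linear_fun_sum PMl); apply: eq_bigr => k' _.
rewrite (linear_funZ PMl) PME (Tbasis_mul hadicUh hth hDeltah hrhoh hcq c_gt0) scalerA.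
rewrite (Tweight _ (inord (i' + k'))) => [|l nl].
  by rewrite fps_coef_constM mulrC.
rewrite fps_coef_constM (CG_weight hth hDeltah hrhoh hcq) ?mul0r //.
apply: contraNneq nl => E0; apply/eqP/val_inj; rewrite /= inordK E0 //.
Qed.
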